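(* Fix $\eta>0$. There exist constants $b,K,\kappa>0$ depending only on $\eta$ such that for every integer $d\geq2$ and every $T>K\,2^{bd}$, the worst-case regret of LB-FTRL with parameter $\eta$ satisfies $$\sup_{r_1,\dots,r_T\in\Delta([d])}\ \max_{u\in\Delta([d])}\sum_{t=1}^T\big(f_t(x_t)-f_t(u)\big)\ \geq\ \kappa\,2^d\log(T)\log\log(T).$$
   Context: Online portfolio problem: $\Delta([d])$ is the probability simplex in $\mathbb{R}^d$. In round $t$ the learner plays $x_t\in\Delta([d])$, then receives a returns vector $r_t\in\Delta([d])$ and suffers $f_t(x_t)$, where $f_t(x)=-\log\langle x,r_t\rangle$. LB-FTRL with constant parameter $\eta>0$ plays $x_t=\arg\min_{x\in\Delta([d])}\big(\eta^{-1}R(x)+\sum_{\tau=1}^{t-1}f_\tau(x)\big)$ with log-barrier regularizer $R(x)=-\sum_{i=1}^d\log(x_i)$. *)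

(* Defs.v *)
From HB Require Import structures.
From mathcomp Require Import all_boot all_order all_algebra.
From mathcomp Require Import all_classical all_reals all_analysis.

Set Implicit Arguments.
Unset Strict Implicit.
Unset Printing Implicit Defensive.

Import Order.TTheory GRing.Theory Num.Theory.

Local Open Scope classical_set_scope.
Local Open Scope ring_scope.
Local Open Scope ereal_scope.

Definition simplex (R : realType) (d : nat) : set 'rV[R]_d :=
  [set x | (forall i, (0 <= x 0%R i)%R) /\ (\sum_(i < d) x 0%R i)%R = 1%R].

Definition dotp (R : realType) (d : nat) (x y : 'rV[R]_d) : R :=
  (\sum_(i < d) x 0 i * y 0 i)%R.

(* Logarithms are extended-real ([lne 0 = -oo]), so that losses and the
   log-barrier are [+oo] where the logarithm's argument vanishes; the
   real-valued [ln] has [ln 0 = 0], which would make boundary points of the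
   simplex spuriously optimal. *)
Definition loss (R : realType) (d : nat) (r x : 'rV[R]_d) : \bar R :=
  - lne (dotp x r)%:E.

Definition log_barrier (R : realType) (d : nat) (x : 'rV[R]_d) : \bar R :=
  - \sum_(i < d) lne (x 0%R i)%:E.

Definition argmin (R : realType) (V : Type) (D : set V) (F : V -> \bar R) :
  set V := [set x | D x /\ forall y, D y -> F x <= F y].

(* On the simplex all terms are in [0, +oo], so no [oo - oo] occurs. *)
Definition ftrl_objective (R : realType) (d : nat) (eta : R)
    (r : nat -> 'rV[R]_d) (t : nat) (x : 'rV[R]_d) : \bar R :=
  (eta^-1)%:E * log_barrier x + \sum_(1 <= tau < t) loss (r tau) x.

(* Rounds are numbered 1, ..., T; values at other indices are irrelevant. *)
Definition returns (R : realType) (d T : nat) (r : nat -> 'rV[R]_d) : Prop :=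
  forall t, (1 <= t <= T)%N -> simplex (r t).

Definition lb_ftrl (R : realType) (d : nat) (eta : R) (T : nat)
    (r x : nat -> 'rV[R]_d) : Prop :=
  forall t, (1 <= t <= T)%N ->
    argmin (@simplex R d) (ftrl_objective eta r t) (x t).

(* LB-FTRL plays have positive coordinates, so [loss (r t) (x t)] is finite and
   a comparator [u] of infinite loss contributes [-oo]. *)
Definition regret (R : realType) (d T : nat) (r x : nat -> 'rV[R]_d) : \bar R :=
  ereal_sup [set \sum_(1 <= t < T.+1) (loss (r t) (x t) - loss (r t) u)
            | u in @simplex R d].

(* The minimizer in each round is unique (the objective is strictly convex), so
   the plays [x] are determined by the returns [r] on rounds 1, ..., T. *)
Definition worst_case_regret (R : realType) (d : nat) (eta : R) (T : nat) :
    \bar R :=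
  ereal_sup [set v | exists r x : nat -> 'rV[R]_d,
    [/\ returns T r, lb_ftrl eta T r x & v = regret T r x]].

(* Main.v *)
(* Rescale the play x after the returns H by the multiplier d/eta + |H| to
   X = (d/eta + |H|) x.  Optimality then reads X_i (1 - sum_v v_i/<X,v>) = 1/eta
   for every asset i, with no simplex constraint left.  The regret against the
   final minimizer is at least the sum of the one-round gaps, and playing v
   costs at least of order (v_i X_i/<X,v>)^2 / X_i for any asset i.  Hence m
   returns close to e_0, starting from X_0 = O(1), cost about
   1 + 1/2 + ... + 1/m = log m.

   To be paid again, reset X_0.  If a past return is v + delta e_c, raising X_c
   far above v_i X_i / delta makes that return almost constant, so that it no
   longer supports the other assets.  Asset 1 is raised K = log log T times by
   factors of order log m, each followed by a fresh harmonic run: this costs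
   about log T log log T.  The remaining d - 2 assets act as the bits of a binary
   counter: every return has a small weight 4^-c on each asset c + 2 whose bit
   is still unset, and setting bit c (raising asset c + 2) silences all earlier
   returns made since bit c was last unset, including those that set the lower
   bits, so the lower bits start again from unset.  The base run is thus played
   2^(d-2) times, while the number of rounds only grows by a factor 256 per bit. *)
Require Import Defs.
From HB Require Import structures.
From mathcomp Require Import all_boot all_order all_algebra.
From mathcomp Require Import all_classical all_reals all_analysis.
From mathcomp Require Import ring lra zify.

Set Implicit Arguments.
Unset Strict Implicit.
Unset Printing Implicit Defensive.

Import Order.TTheory GRing.Theory Num.Theory.
Import numFieldNormedType.Exports.

Local Open Scope classical_set_scope.
Local Open Scope ring_scope.

(** * Follow the regularized leader *)

Lemma cvg_sum_seq (R : realType) (T : topologicalType) (I : eqType)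
    (s : seq I) (F : I -> T -> R) (a : T) :
  {in s, forall i, F i x @[x --> a] --> F i a} ->
  \sum_(i <- s) F i x @[x --> a] --> \sum_(i <- s) F i a.
Proof.
elim: s => [_|i s IH h].
  under eq_fun do rewrite big_nil.
  by rewrite big_nil; exact: cvg_cst.
under eq_fun do rewrite big_cons.
rewrite big_cons; apply: cvgD.
  by apply: h; rewrite mem_head.
by apply: IH => j js; apply: h; rewrite in_cons js orbT.
Qed.

(** From [ln y <= y - 1] at [y = 1 / (1 + u)] one gets [u / (1 + u) <= ln (1 + u)], and [(u -
    2u^2)(1 + u) = u - u^2 (1 + 2u) <= u]. *)
Lemma ln1D_ge (R : realType) (u : R) :
  - 2^-1 <= u -> u - 2 * u ^+ 2 <= ln (1 + u).
Proof.
move=> hu; have u1 : 0 < 1 + u by lra.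
apply: (@le_trans _ _ (u / (1 + u))).
  rewrite ler_pdivlMr//.
  have -> : (u - 2 * u ^+ 2) * (1 + u) = u - u ^+ 2 * (1 + 2 * u) by ring.
  by rewrite gerBl mulr_ge0 ?sqr_ge0//; lra.
rewrite -[ln _]opprK -lnV ?posrE// lerNr.
rewrite [X in ln X](_ : _ = 1 + - (u / (1 + u))); last by field; lra.
apply: le_ln1Dx.
by rewrite ltrN2 ltr_pdivrMr//; lra.
Qed.

(** * The objective on the open simplex and its minimizer *)

Section FTRL.
Variables (R : realType) (n : nat) (eta : R).
Hypothesis eta_gt0 : 0 < eta.
Notation V := 'rV[R]_n.+1.

Definition open_simplex : set V :=
  [set x | (forall i, 0 < x 0 i) /\ \sum_i x 0 i = 1].

(** Returns stay unnormalized during the construction: scaling a return only adds a constant to its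
    loss, so minimizers do not change. *)
Definition admissible (v : V) : Prop :=
  (forall i, 0 <= v 0 i) /\ exists i, 0 < v 0 i.

Definition obj (H : seq V) (x : V) : R :=
  - (eta^-1 * \sum_i ln (x 0 i)) - \sum_(v <- H) ln (dotp x v).

Lemma dotp_gt0 (x v : V) : (forall i, 0 < x 0 i) -> admissible v -> 0 < dotp x v.
Proof.
move=> x0 [v0 [i vi]]; rewrite /dotp (bigD1 i)//=.
rewrite ltr_pwDl ?mulr_gt0// sumr_ge0// => j _.
by rewrite mulr_ge0// ltW.
Qed.

Lemma open_simplexW (x : V) : open_simplex x -> simplex x.
Proof. by move=> [x0 x1]; split=> // i; exact: ltW. Qed.

Lemma simplex_le1 (x : V) i : simplex x -> x 0 i <= 1.
Proof. by move=> [x0 <-]; rewrite (bigD1 i)//= lerDl sumr_ge0. Qed.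

Lemma open_simplex_le1 (x : V) i : open_simplex x -> x 0 i <= 1.
Proof. by move=> /open_simplexW; exact: simplex_le1. Qed.

(** One small coordinate already makes the barrier large: the logarithms of the other coordinates
    are nonpositive, and [dotp x v] is at most the total weight of [v]. *)
Lemma obj_ge (H : seq V) (x : V) (mu : R) i : {in H, forall v, admissible v} ->
  open_simplex x -> x 0 i <= mu ->
  - (eta^-1 * ln mu) - \sum_(v <- H) ln (\sum_j v 0 j) <= obj H x.
Proof.
move=> Hadm xS xmu; have [x0 x1] := xS.
apply: lerD.
  rewrite lerN2; apply: ler_wpM2l; first by rewrite invr_ge0 ltW.
  rewrite (bigD1 i)//= -[ln mu]addr0 lerD//.
    by rewrite ler_ln ?posrE// (lt_le_trans (x0 i)).
  by rewrite sumr_le0// => j _; rewrite ln_le0// open_simplex_le1.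
rewrite lerN2 big_seq [X in _ <= X]big_seq; apply: ler_sum => v vH.
have d0 := dotp_gt0 x0 (Hadm _ vH).
have dle : dotp x v <= \sum_j v 0 j.
  apply: ler_sum => j _; rewrite ler_piMl//; first by have [] := Hadm _ vH.
  exact: open_simplex_le1.
by rewrite ler_ln ?posrE// (lt_le_trans d0).
Qed.

Lemma continuous_obj (H : seq V) (x : V) : {in H, forall v, admissible v} ->
  (forall i, 0 < x 0 i) -> {for x, continuous (obj H)}.
Proof.
move=> Hadm x0.
have c1 : (fun y : V => \sum_i ln (y 0 i)) y @[y --> x] --> \sum_i ln (x 0 i).
  apply: cvg_sum_seq => i _.
  apply: (@cvg_comp _ _ _ (fun y : V => y 0 i) (@ln R)); first exact: coord_continuous.
  exact: continuous_ln.
have c2 : \sum_(v <- H) ln (dotp y v) @[y --> x] --> \sum_(v <- H) ln (dotp x v).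
  apply: cvg_sum_seq => v vH.
  apply: (@cvg_comp _ _ _ (fun y : V => dotp y v) (@ln R)); last first.
    by apply: continuous_ln; apply: dotp_gt0 => //; exact: Hadm.
  apply: (@cvg_sum_seq R V _ _ (fun i (y : V) => y 0 i * v 0 i)) => i _.
  exact: (cvgM (@coord_continuous R _ _ 0 i x) (cvg_cst (v 0 i))).
have c3 : (fun y : V => - (eta^-1 * \sum_i ln (y 0 i))) y @[y --> x] -->
    - (eta^-1 * \sum_i ln (x 0 i)).
  exact: (cvgN (cvgM (cvg_cst eta^-1) c1)).
exact: (cvgB c3 c2).
Qed.

Definition is_min (H : seq V) (x : V) : Prop :=
  open_simplex x /\ forall y, open_simplex y -> obj H x <= obj H y.

Lemma is_min_ex (H : seq V) : {in H, forall v, admissible v} ->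
  exists x, is_min H x.
Proof.
move=> Hadm.
pose u : V := const_mx (n.+1%:R^-1).
have n0 : 0 < n.+1%:R^-1 :> R by rewrite invr_gt0 ltr0n.
have uS : open_simplex u.
  split=> [i|]; first by rewrite mxE.
  under eq_bigr do rewrite mxE.
  by rewrite sumr_const card_ord -[LHS]mulr_natr mulVf// pnatr_eq0.
pose C := \sum_(v <- H) ln (\sum_j v 0 j).
(* By [obj_ge], a point with a coordinate at most [mu] is no better than the uniform point [u]; this
   confines the search to a compact set containing [u]. *)
pose mu : R := Num.min (n.+1%:R^-1) (expR (- (eta * (obj H u + C)))).
have mu0 : 0 < mu by rewrite lt_min n0 expR_gt0.
pose A : set V :=
  [set x : V | forall i, `[mu, 1]%classic (x ord0 i)] `&` [set x : V | \sum_i x 0 i = 1].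
have Apos x : A x -> open_simplex x.
  move=> [h1 h2]; split=> // i; have := h1 i.
  by rewrite /= in_itv/= => /andP[h _]; exact: lt_le_trans h.
have Au : A u.
  split; last by have [] := uS.
  move=> i; rewrite /= in_itv/= mxE ge_min lexx/=.
  by rewrite invf_le1 ?ltr0n// ler1n.
have cA : compact A.
  apply: compact_closedI.
    apply: (@rV_compact R n.+1 (fun=> `[mu, 1]%classic)) => i.
    exact: segment_compact.
  apply: (@preimage_closed _ _ (fun x : V => \sum_i x 0 i) [set x | x = 1]).
    move=> x _; apply: cvg_sum_seq => i _; exact: coord_continuous.
  exact: closed_eq.
have [|x xA xmin] := @EVT_min_rV R n.+1 (obj H) A (ex_intro _ u Au) cA.
  apply: continuous_in_subspaceT => x; rewrite inE => /Apos[x0 _].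
  exact: continuous_obj.
rewrite inE in xA.
exists x; split; first exact: Apos.
move=> y yS; have [yA|yA] := pselect (A y); first by apply: xmin; rewrite inE.
have xu : obj H x <= obj H u by apply: xmin; rewrite inE.
apply: le_trans xu _.
have [i yi] : exists i, y 0 i <= mu.
  apply: contrapT => /forallNP h; apply: yA; split; last by have [] := yS.
  move=> i; rewrite /= in_itv/= open_simplex_le1// andbT.
  by have /negP := h i; rewrite -ltNge => /ltW.
apply: le_trans (obj_ge Hadm yS yi).
rewrite -/C lerBrDr lerNr -ler_pdivlMl ?invr_gt0// invrK.
have : ln mu <= ln (expR (- (eta * (obj H u + C)))).
  by rewrite ler_ln ?posrE ?expR_gt0// ge_min lexx orbT.
by rewrite expRK mulrN.
Qed.

(** * Shares, boosts and the first-order condition *)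

Definition share (x v : V) i : R := v 0 i * x 0 i / dotp x v.

Lemma share_itv (x v : V) i : (forall i, 0 < x 0 i) -> admissible v ->
  0 <= share x v i <= 1.
Proof.
move=> x0 va; have d0 := dotp_gt0 x0 va; have [v0 _] := va.
rewrite divr_ge0 ?mulr_ge0 ?(ltW (x0 _)) ?(ltW d0)//= ler_pdivrMr// mul1r.
rewrite /dotp (bigD1 i)//= mulrC lerDl sumr_ge0// => j _.
by rewrite mulr_ge0 ?(ltW (x0 _)).
Qed.

(* Asset [i] is multiplied by [1 + s] before renormalisation. *)
Definition boost (x : V) i (s : R) : V :=
  (1 + s * x 0 i)^-1 *: \row_j (x 0 j * (if j == i then 1 + s else 1)).

Section Boost.
Variables (x : V) (i : 'I_n.+1) (s : R).
Hypotheses (xS : open_simplex x) (s_gtN1 : -1 < s).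

Lemma boost_norm_gt0 : 0 < 1 + s * x 0 i.
Proof.
have [x0 _] := xS; have := open_simplex_le1 i xS; have := x0 i.
by move: s_gtN1; nra.
Qed.

Lemma boost_open_simplex : open_simplex (boost x i s).
Proof.
have h := boost_norm_gt0; have [x0 x1] := xS.
split=> [j|].
  rewrite !mxE mulr_gt0 ?invr_gt0 ?mulr_gt0//.
  by case: ifP => _ //; move: s_gtN1; lra.
under eq_bigr do rewrite !mxE.
rewrite -mulr_sumr (bigD1 i)//= eqxx.
under eq_bigr => j /negPf -> do rewrite mulr1.
move: x1; rewrite (bigD1 i)//= => x1.
rewrite [X in _ * X](_ : _ = 1 + s * x 0 i) ?mulVf ?gt_eqF//.
by lra.
Qed.

Lemma dotp_boost v : admissible v ->
  dotp (boost x i s) v = (1 + s * x 0 i)^-1 * (dotp x v * (1 + s * share x v i)).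
Proof.
move=> va; have d0 : dotp x v != 0 by rewrite gt_eqF// dotp_gt0//; case: xS.
have -> : dotp x v * (1 + s * share x v i) = dotp x v + s * (v 0 i * x 0 i).
  by rewrite /share; field.
rewrite /dotp; under eq_bigr do rewrite !mxE -mulrA.
rewrite -mulr_sumr; congr (_ * _).
rewrite (bigD1 i)//= [in RHS](bigD1 i)//= eqxx.
under eq_bigr => j /negPf -> do rewrite mulr1.
ring.
Qed.

(** The renormalizing factor enters once per coordinate, with weight [eta^-1], and once per past
    return, whence the coefficient of the last logarithm. *)
Lemma obj_boost H : {in H, forall v, admissible v} ->
  obj H (boost x i s) = obj H x - eta^-1 * ln (1 + s)
    - \sum_(v <- H) ln (1 + s * share x v i)
    + (eta^-1 * n.+1%:R + (size H)%:R) * ln (1 + s * x 0 i).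
Proof.
move=> Hadm; have h := boost_norm_gt0; have [x0 x1] := xS.
have s1 : 0 < 1 + s by move: s_gtN1; lra.
rewrite /obj.
have -> : \sum_j ln (boost x i s 0 j)
    = \sum_j ln (x 0 j) + ln (1 + s) - n.+1%:R * ln (1 + s * x 0 i).
  have -> : n.+1%:R * ln (1 + s * x 0 i) = \sum_(j < n.+1) ln (1 + s * x 0 i).
    by rewrite sumr_const card_ord mulr_natl.
  rewrite addrAC -sumrB (bigD1 i)//= [in RHS](bigD1 i)//=.
  rewrite !mxE eqxx lnM ?posrE ?invr_gt0 ?mulr_gt0// lnV ?posrE// lnM ?posrE//.
  under eq_bigr => j ji do
    rewrite !mxE (negPf ji) mulr1 lnM ?posrE ?invr_gt0// lnV ?posrE// addrC.
  ring.
have -> : \sum_(v <- H) ln (dotp (boost x i s) v) = \sum_(v <- H) ln (dotp x v)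
    + \sum_(v <- H) ln (1 + s * share x v i) - (size H)%:R * ln (1 + s * x 0 i).
  have -> : (size H)%:R * ln (1 + s * x 0 i) = \sum_(v <- H) ln (1 + s * x 0 i).
    by rewrite big_const_seq count_predT iter_addr_0 mulr_natl.
  rewrite -big_split/= -sumrB big_seq [RHS]big_seq; apply: eq_bigr => v vH.
  have va := Hadm _ vH; have d0 := dotp_gt0 x0 va.
  have /andP[sh0 sh1] := share_itv i x0 va.
  have p0 : 0 < 1 + s * share x v i.
    have [->|sN0] := eqVneq (share x v i) 0; first by rewrite mulr0 addr0.
    have -> : 1 + s * share x v i = (1 - share x v i) + share x v i * (1 + s) by ring.
    by rewrite ltr_wpDl ?subr_ge0// mulr_gt0// lt0r sN0.
  rewrite dotp_boost// lnM ?posrE ?invr_gt0 ?mulr_gt0// lnV ?posrE// lnM ?posrE//.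
  ring.
ring.
Qed.

End Boost.

(** Second-order expansion through [ln1D_ge]. Shares lie in [0, 1], so their squares are at most the
    shares themselves, and the same sum controls the linear and the quadratic term. *)
Lemma obj_boost_le H x i s : {in H, forall v, admissible v} -> open_simplex x ->
  - 2^-1 <= s <= 2^-1 ->
  obj H (boost x i s) <= obj H x
    + s * ((eta^-1 * n.+1%:R + (size H)%:R) * x 0 i
           - (eta^-1 + \sum_(v <- H) share x v i))
    + 2 * s ^+ 2 * (eta^-1 + \sum_(v <- H) share x v i).
Proof.
move=> Hadm xS /andP[s1 s2]; have [x0 x1] := xS.
have xi1 := open_simplex_le1 i xS.
have e0 : 0 < eta^-1 by rewrite invr_gt0.
rewrite obj_boost//; last by lra.
have h1 : eta^-1 * (s - 2 * s ^+ 2) <= eta^-1 * ln (1 + s).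
  by rewrite ler_pM2l//; exact: ln1D_ge.
have h2 : (s - 2 * s ^+ 2) * \sum_(v <- H) share x v i
    <= \sum_(v <- H) ln (1 + s * share x v i).
  rewrite mulr_sumr big_seq [X in _ <= X]big_seq; apply: ler_sum => v vH.
  have /andP[sh0 sh1] := share_itv i x0 (Hadm _ vH).
  apply: le_trans (ln1D_ge _); last by nra.
  rewrite exprMn.
  have : 0 <= s ^+ 2 * share x v i * (1 - share x v i).
    by apply: mulr_ge0; [apply: mulr_ge0 => //; exact: sqr_ge0|rewrite subr_ge0].
  by rewrite expr2; nra.
have h3 : (eta^-1 * n.+1%:R + (size H)%:R) * ln (1 + s * x 0 i)
    <= (eta^-1 * n.+1%:R + (size H)%:R) * (s * x 0 i).
  apply: ler_wpM2l; first by rewrite addr_ge0// mulr_ge0// ltW.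
  apply: le_ln1Dx; have := x0 i; nra.
move: h1 h2 h3.
set S := \sum_(v <- H) share x v i; set L2 := \sum_(v <- H) ln _.
set L1 := ln (1 + s); set L3 := ln _; set N := _ + (size H)%:R.
move=> h1 h2 h3.
lra.
Qed.

(** If the first-order defect [A] were nonzero, a small boost of sign opposite to [A] would lower
    the objective. *)
Lemma is_min_fixpoint H x i : {in H, forall v, admissible v} -> is_min H x ->
  (eta^-1 * n.+1%:R + (size H)%:R) * x 0 i
    = eta^-1 + \sum_(v <- H) share x v i.
Proof.
move=> Hadm [xS xmin]; have [x0 x1] := xS.
apply/eqP; rewrite -subr_eq0; set A := _ - _; apply/negPn/negP => A0.
have A_gt0 : 0 < `|A| by rewrite normr_gt0.
set C := eta^-1 + \sum_(v <- H) share x v i.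
have C0 : 0 < C.
  rewrite ltr_pwDl ?invr_gt0// big_seq sumr_ge0// => v vH.
  by have /andP[] := share_itv i x0 (Hadm _ vH).
(* This [D] ensures [|s| <= 1/2] and [2 * C < D], so the quadratic loss stays below the linear gain
   [A^2 / D]. *)
pose D := 2 * `|A| + 4 * C.
have D0 : 0 < D by rewrite addr_gt0// mulr_gt0.
pose s := - A / D.
have sE : s * A = - (`|A| ^+ 2 / D) by rewrite real_normK ?num_real// /s expr2; ring.
have s2E : s ^+ 2 = `|A| ^+ 2 / D ^+ 2.
  by rewrite real_normK ?num_real// /s expr_div_n sqrrN.
have sI : - 2^-1 <= s <= 2^-1.
  rewrite -ler_norml /s normrM normrN normfV (gtr0_norm D0) ler_pdivrMr// /D.
  by move: C0 A_gt0; lra.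
have s_gtN1 : -1 < s by case/andP: sI => ? ?; lra.
have := xmin _ (boost_open_simplex i xS s_gtN1).
rewrite leNgt => /negP; apply.
apply: le_lt_trans (obj_boost_le i Hadm xS sI) _.
rewrite -/C -/A sE s2E -addrA gtrDl.
have -> : 2 * (`|A| ^+ 2 / D ^+ 2) * C = `|A| ^+ 2 / D * (2 * C / D).
  by field; rewrite gt_eqF.
rewrite addrC subr_lt0 gtr_pMr ?divr_gt0 ?exprn_gt0//.
by rewrite ltr_pdivrMr// mul1r /D; lra.
Qed.

(** * Plays and one-round gaps *)

Definition play (H : seq V) : V := xget 0 (is_min H).

Lemma playP H : {in H, forall v, admissible v} -> is_min H (play H).
Proof. by move=> Hadm; apply: xgetPex; exact: is_min_ex. Qed.

(** What the old minimizer loses against the new one once [v] is known; [total_gapE] telescopes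
    these amounts. *)
Definition gap (H : seq V) (v : V) : R :=
  obj (rcons H v) (play H) - obj (rcons H v) (play (rcons H v)).

Lemma gap_ge0 H v : {in H, forall v, admissible v} -> admissible v ->
  0 <= gap H v.
Proof.
move=> Hadm va; rewrite subr_ge0.
have [_ h] : is_min (rcons H v) (play (rcons H v)).
  apply: playP => w; rewrite mem_rcons in_cons => /predU1P[->//|].
  exact: Hadm.
by apply: h; have [] := playP Hadm.
Qed.

(* The scaling factor is the Lagrange multiplier of the simplex constraint. *)
Definition scaled_play (H : seq V) : V :=
  (eta^-1 * n.+1%:R + (size H)%:R) *: play H.

Lemma share_scale c x v i : c != 0 -> share (c *: x) v i = share x v i.
Proof.
move=> c0; rewrite /share.
have -> : dotp (c *: x) v = c * dotp x v.
  by rewrite /dotp mulr_sumr; apply: eq_bigr => j _; rewrite mxE mulrA.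
have [->|d0] := eqVneq (dotp x v) 0; first by rewrite mulr0 invr0 !mulr0.
by rewrite mxE; field; rewrite d0 c0.
Qed.

(* One step along [boost] gains sg and loses at most the curvature, which is
   bounded by X_i because shares are at most 1, hence squared shares sum to at
   most the sum of the shares. *)
Lemma gap_ge H v i (sg : R) : {in H, forall v, admissible v} -> admissible v ->
  0 < sg <= 1 -> let X := scaled_play H in
  sg <= share X v i -> X 0 i <= sg / 2 * \sum_j X 0 j ->
  sg ^+ 2 / (32 * (X 0 i + 1)) <= gap H v.
Proof.
move=> Hadm va /andP[sg0 sg1] X.
have pm := playP Hadm; have [xS _] := pm; have [x0 x1] := xS.
set N : R := eta^-1 * n.+1%:R + (size H)%:R.
have N0 : 0 < N by rewrite ltr_pwDl// mulr_gt0 ?invr_gt0.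
have -> : \sum_j X 0 j = N.
  under eq_bigr do rewrite mxE.
  by rewrite -mulr_sumr x1 mulr1.
rewrite share_scale ?gt_eqF// => hsh hX.
have XE : X 0 i = N * play H 0 i by rewrite mxE.
have Xi0 : 0 < X 0 i by rewrite XE mulr_gt0.
have xi : play H 0 i <= sg / 2.
  by rewrite -(ler_pM2l N0) -XE mulrC.
have Hv : {in rcons H v, forall v, admissible v}.
  by move=> w; rewrite mem_rcons in_cons => /predU1P[->//|]; exact: Hadm.
(* This [s] maximizes [s * sg / 2 - 2 * s^2 * (X_i + 1)]. The other half of [sg] pays for the
   additional round in the normalization, as [play H 0 i <= sg / 2]. *)
pose s := sg / (8 * (X 0 i + 1)).
have D0 : 0 < 8 * (X 0 i + 1) by lra.
have s0 : 0 < s by rewrite divr_gt0.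
have s2 : s <= 2^-1 by rewrite ler_pdivrMr//; lra.
have sI : - 2^-1 <= s <= 2^-1 by rewrite s2 andbT; lra.
have := obj_boost_le i Hv xS sI.
rewrite size_rcons -cats1 big_cat big_seq1/= -(natr1 (size H)) addrA -/N.
have [_ vmin] := playP Hv.
have {}vmin : obj (H ++ [:: v]) (play (H ++ [:: v]))
    <= obj (H ++ [:: v]) (boost (play H) i s).
  rewrite cats1; apply: vmin; apply: boost_open_simplex => //; lra.
have fx := is_min_fixpoint i Hadm pm; rewrite -/N -XE in fx.
rewrite mulrDl mul1r -XE addrA -fx => hb.
have /andP[sh0 sh1] := share_itv i x0 va.
rewrite /gap -cats1.
have hs : sg ^+ 2 / (32 * (X 0 i + 1)) = s * sg / 2 - 2 * s ^+ 2 * (X 0 i + 1).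
  by rewrite /s; field; lra.
have h1 : s * (play H 0 i - share (play H) v i) <= s * (- (sg / 2)).
  by rewrite ler_pM2l//; lra.
have h2 : s ^+ 2 * (X 0 i + share (play H) v i) <= s ^+ 2 * (X 0 i + 1).
  by rewrite ler_pM2l ?exprn_gt0//; lra.
rewrite hs; move: hb vmin h1 h2.
set o1 := obj _ _; set o2 := obj _ _; set o3 := obj _ _; lra.
Qed.

(** The pull of the history [H] on asset [i]: minus the partial derivative of its summed losses. *)
Definition grad (H : seq V) (X : V) i : R := \sum_(v <- H) v 0 i / dotp X v.

Lemma scaled_play_gt0 H i : {in H, forall v, admissible v} ->
  0 < scaled_play H 0 i.
Proof.
move=> Hadm; have [[x0 _] _] := playP Hadm.
by rewrite mxE mulr_gt0// ltr_pwDl// mulr_gt0 ?invr_gt0.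
Qed.

(** This is [is_min_fixpoint] rescaled: shares are scale invariant, and [X_i * (v_i / <X, v>)] is
    the share of asset [i]. *)
Lemma scaled_play_grad H i : {in H, forall v, admissible v} ->
  let X := scaled_play H in X 0 i * (1 - grad H X i) = eta^-1.
Proof.
move=> Hadm X; have pm := playP Hadm; have [[x0 _] _] := pm.
have N0 : 0 < eta^-1 * n.+1%:R + (size H)%:R.
  by rewrite ltr_pwDl// mulr_gt0 ?invr_gt0.
have fx := is_min_fixpoint i Hadm pm.
have XE : X 0 i = eta^-1 + \sum_(v <- H) share X v i.
  rewrite mxE fx; congr (_ + _); apply: eq_bigr => v _.
  by rewrite share_scale// gt_eqF.
rewrite mulrBr mulr1 {1}XE /grad mulr_sumr.
under [in X in _ - X]eq_bigr => v _ do rewrite mulrA [X _ _ * _]mulrC.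
by rewrite addrK.
Qed.

Fixpoint total_gap (H P : seq V) : R :=
  if P is v :: P' then gap H v + total_gap (rcons H v) P' else 0.

Lemma total_gap_cat H P Q :
  total_gap H (P ++ Q) = total_gap H P + total_gap (H ++ P) Q.
Proof.
elim: P H => [|v P IH] H /=; first by rewrite add0r cats0.
by rewrite IH addrA cat_rcons.
Qed.

Lemma total_gap_ge0 H P : {in H ++ P, forall v, admissible v} ->
  0 <= total_gap H P.
Proof.
elim: P H => //= v P IH H Hadm; rewrite addr_ge0//.
  apply: gap_ge0 => [w wH|]; apply: Hadm.
    by rewrite mem_cat wH.
  by rewrite mem_cat mem_head orbT.
by apply: IH; rewrite cat_rcons.
Qed.

End FTRL.

(** * The binary counter *)

Section Grad.
Variables (R : realType) (n : nat).
Implicit Types (H P : seq 'rV[R]_n.+1) (X v w : 'rV[R]_n.+1).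

Lemma grad_cat H P X i : grad (H ++ P) X i = grad H X i + grad P X i.
Proof. by rewrite /grad big_cat. Qed.

Lemma grad_nseq k v X i : grad (nseq k v) X i = k%:R * (v 0 i / dotp X v).
Proof. by rewrite /grad big_nseq iter_addr_0 mulr_natl. Qed.

Lemma grad_ge0 H X i : {in H, forall v, admissible v} -> (forall i, 0 < X 0 i) ->
  0 <= grad H X i.
Proof.
move=> Hadm X0; rewrite /grad big_seq sumr_ge0// => v vH.
have va := Hadm _ vH; rewrite divr_ge0//; first by case: va.
exact/ltW/dotp_gt0.
Qed.

Lemma grad_le_sum H X i (tau : R) : {in H, forall v, admissible v} -> 0 < tau ->
  {in H, forall v, tau <= dotp X v} ->
  grad H X i <= (\sum_(v <- H) v 0 i) / tau.
Proof.
move=> Hadm tau0 Htau; rewrite /grad mulr_suml big_seq [X in _ <= X]big_seq.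
apply: ler_sum => v vH; have [v0 _] := Hadm _ vH.
by rewrite ler_wpM2l// lef_pV2 ?posrE ?Htau// (lt_le_trans tau0)// Htau.
Qed.

Lemma ler_dotp X v w : (forall i, 0 < X 0 i) -> (forall i, v 0 i <= w 0 i) ->
  dotp X v <= dotp X w.
Proof. by move=> X0 vw; apply: ler_sum => i _; rewrite ler_pM2l. Qed.

End Grad.

Section Counter.
Variables (R : realType) (D : nat) (eta : R).
Hypothesis eta_gt0 : 0 < eta.
Notation V := 'rV[R]_D.+2.
Implicit Types (H O P : seq V) (X v : V) (s : nat -> bool).

(** Inequalities implied by the equations [X_i (1 - grad_i) = eta^-1]. Unlike the equations, they
    pass to prefixes and suffixes of the history. *)
Definition feasible O X : Prop :=
  (forall i, eta^-1 <= X 0 i) /\ forall i, grad O X i <= 1.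

Lemma feasible_gt0 O X i : feasible O X -> 0 < X 0 i.
Proof. by move=> [h _]; rewrite (lt_le_trans _ (h i))// invr_gt0. Qed.

Lemma feasible_catl O P X : {in P, forall v, admissible v} ->
  feasible (O ++ P) X -> feasible O X.
Proof.
move=> Padm f; have X0 i := feasible_gt0 i f; case: f => f1 f2.
split=> // i; apply: le_trans (f2 i); rewrite grad_cat lerDl.
exact: grad_ge0.
Qed.

Lemma feasible_catr O P X : {in O, forall v, admissible v} ->
  feasible (O ++ P) X -> feasible P X.
Proof.
move=> Oadm f; have X0 i := feasible_gt0 i f; case: f => f1 f2.
split=> // i; apply: le_trans (f2 i); rewrite grad_cat lerDr.
exact: grad_ge0.
Qed.

Lemma scaled_play_feasible H : {in H, forall v, admissible v} ->
  feasible H (scaled_play eta H).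
Proof.
move=> Hadm; have X0 i := scaled_play_gt0 eta_gt0 i Hadm.
have g0 i := grad_ge0 i Hadm X0.
have XE i := scaled_play_grad eta_gt0 i Hadm.
split=> i; first by rewrite -(XE i) ger_pMr// gerBl.
have : 0 < scaled_play eta H 0 i * (1 - grad H (scaled_play eta H) i).
  by rewrite XE invr_gt0.
by rewrite pmulr_rgt0// subr_gt0 => /ltW.
Qed.

(* Asset [c + 2] carries bit [c] of the counter; [s c = true] means that this bit
   is still unset. *)
Definition tail n s : V :=
  \row_(i < D.+2) (if (n.+2 <= i)%N && s (i - 2)%N then 4^-1 ^+ (i - 2) else 0).

Definition upd s n b : nat -> bool := fun c => if c == n then b else s c.

Lemma tail_ge0 n s i : 0 <= tail n s 0 i.
Proof. by rewrite mxE; case: ifP => // _; rewrite exprn_ge0. Qed.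

Lemma tail_le n s i : tail n s 0 i <= 4^-1 ^+ (i - 2).
Proof. by rewrite mxE; case: ifP => // _; rewrite exprn_ge0. Qed.

Lemma tail_lt n s (i : 'I_D.+2) : (i < n.+2)%N -> tail n s 0 i = 0.
Proof. by move=> h; rewrite mxE leqNgt h. Qed.

Lemma tailS_upd n s b i : tail n.+1 s 0 i <= tail n (upd s n b) 0 i.
Proof.
rewrite !mxE /upd; case: ifP => [/andP[ni si]|_]; last first.
  by case: ifP => // _; rewrite exprn_ge0.
have -> : (i - 2 == n)%N = false by apply/eqP; lia.
by rewrite si (ltnW ni).
Qed.

Lemma tail_diag n s (i : 'I_D.+2) : i = n.+2 :> nat ->
  tail n (upd s n true) 0 i = 4^-1 ^+ n.
Proof.
move=> iE; rewrite mxE /upd.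
by rewrite (_ : (i - 2)%N = n) ?eqxx ?iE ?leqnn//; lia.
Qed.

Lemma tail_admissible n s : (n < D)%N -> admissible (tail n (upd s n true)).
Proof.
move=> nD; split=> [i|]; first exact: tail_ge0.
have nD2 : (n.+2 < D.+2)%N by [].
by exists (Ordinal nD2); rewrite tail_diag// exprn_gt0.
Qed.

(** * The recursive counter over an abstract base run *)

Variables (B Bt : nat) (base : (nat -> bool) -> seq V).
Hypotheses (B_gt0 : (0 < B)%N) (Bt_gt0 : (0 < Bt)%N).
Hypothesis base_admissible : forall s, {in base s, forall v, admissible v}.
Hypothesis base_tail :
  forall s, {in base s, forall v i, tail 0 s 0 i <= v 0 i}.
Hypothesis base_le_Bt : forall s,
  {in base s, forall v (i : 'I_D.+2), (i < 2)%N -> v 0 i <= Bt%:R}.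
Hypothesis base_le : forall s,
  {in base s, forall v (i : 'I_D.+2), (2 <= i)%N -> v 0 i <= 4^-1 ^+ (i - 2)}.
Hypothesis size_base : forall s, (size (base s) <= B)%N.

(** Raising bit [n] forces its returns to be worth at least [level n] ([raise_dotp]). This is at
    least 16 times the weight that [counter n] accumulates on any asset, thanks to the factor 64 per
    bit. *)
Definition level n : nat := 16 * B * Bt * 64 ^ n.

(** The factor [4 ^ n'] in the number of raising returns offsets their weight [4^-1 ^+ n'] on the
    raised asset. *)
Fixpoint counter n s : seq V :=
  if n is n'.+1 then
    counter n' (upd s n' true) ++
    nseq (level n' * 4 ^ n') (tail n' (upd s n' true)) ++
    counter n' (upd s n' false)
  else base s.

(** Turns a lower bound on the value of the raising return into one for all the returns that it has
    to silence. *)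
Lemma counter_tail n s : {in counter n s, forall v i, tail n s 0 i <= v 0 i}.
Proof.
elim: n s => [|n IH] s v /=; first exact: base_tail.
rewrite !mem_cat => /or3P[vc|/nseqP[-> _]|vc] i.
- exact: le_trans (tailS_upd _ _ _ _) (IH _ _ vc i).
- exact: tailS_upd.
- exact: le_trans (tailS_upd _ _ _ _) (IH _ _ vc i).
Qed.

Lemma counter_admissible n s : (n <= D)%N ->
  {in counter n s, forall v, admissible v}.
Proof.
elim: n s => [|n IH] s nD v /=; first exact: base_admissible.
rewrite !mem_cat => /or3P[vc|/nseqP[-> _]|vc].
- by apply: IH vc; exact: ltnW.
- exact: tail_admissible.
- by apply: IH vc; exact: ltnW.
Qed.

Lemma size_counter n s : (size (counter n s) <= level n * 4 ^ n)%N.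
Proof.
elim: n s => [|n IH] s /=.
  by apply: leq_trans (size_base s) _; rewrite /level !expn0; nia.
rewrite !size_cat size_nseq.
have := IH (upd s n true); have := IH (upd s n false).
rewrite /level !expnS; nia.
Qed.

Lemma counter_sum_lt2 n s (i : 'I_D.+2) : (i < 2)%N ->
  \sum_(v <- counter n s) v 0 i <= (2 ^ n * B * Bt)%:R.
Proof.
move=> i2; elim: n s => [|n IH] s /=.
  apply: (@le_trans _ _ (\sum_(v <- base s) Bt%:R)).
    rewrite big_seq [X in _ <= X]big_seq; apply: ler_sum => v vb.
    exact: base_le_Bt vb _ i2.
  rewrite big_const_seq count_predT iter_addr_0 -[X in X <= _]mulr_natr -natrM ler_nat.
  by have := size_base s; rewrite expn0; nia.
rewrite !big_cat/= big_nseq iter_addr_0 tail_lt ?mul0rn ?add0r; last first.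
  by rewrite (leq_trans i2).
apply: le_trans (lerD (IH _) (IH _)) _.
by rewrite -natrD ler_nat expnS; nia.
Qed.

(** Subtraction is truncated, so the exponent is the distance between [n] and [c]. *)
Definition decay n c : R := 2^-1 ^+ ((n - c) + (c - n)).

Lemma decay_gt0 n c : 0 < decay n c.
Proof. by rewrite exprn_gt0. Qed.

Lemma decayS_lt n c : (c < n)%N -> decay n c = 2 * decay n.+1 c.
Proof.
move=> cn; rewrite /decay.
have -> : ((n.+1 - c) + (c - n.+1) = ((n - c) + (c - n)).+1)%N by lia.
by rewrite exprS mulrA mulfV// mul1r.
Qed.

Lemma decayS_gt n c : (n < c)%N -> decay n.+1 c = 2 * decay n c.
Proof.
move=> nc; rewrite /decay.
have -> : ((n - c) + (c - n) = ((n.+1 - c) + (c - n.+1)).+1)%N by lia.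
by rewrite exprS mulrA mulfV// mul1r.
Qed.

Lemma decaynn n : decay n n = 1.
Proof. by rewrite /decay subnn. Qed.

Lemma decaySnn n : decay n.+1 n = 2^-1.
Proof. by rewrite /decay (_ : (_ + _ = 1)%N); last lia. Qed.

Lemma decayS_ge n c : decay n c <= 2 * decay n.+1 c.
Proof.
have [cn|nc|->] := ltngtP c n; first by rewrite -decayS_lt.
  by rewrite (decayS_gt nc); have := decay_gt0 n c; lra.
by rewrite decaynn decaySnn; lra.
Qed.

Lemma exp4V_decay n c : (n <= c)%N -> 4^-1 ^+ (c - n) <= decay n c.
Proof.
move=> nc; rewrite /decay (eqP nc : (n - c)%N = 0%N) add0n.
by apply: lerXn2r; rewrite ?nnegrE ?invr_ge0//; lra.
Qed.

Lemma exp4V_decay_half n c : (n < c)%N -> 4^-1 ^+ (c - n) <= decay n c / 2.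
Proof.
move=> nc; rewrite (_ : (c - n = (c - n.+1).+1)%N); last by lia.
rewrite exprS; have := exp4V_decay nc; rewrite (decayS_gt nc).
have := decay_gt0 n c; lra.
Qed.

Lemma level_gt0 n : 0 < (level n)%:R :> R.
Proof. by rewrite ltr0n !muln_gt0 expn_gt0 B_gt0 Bt_gt0. Qed.

Lemma levelS n : (level n.+1)%:R = 64 * (level n)%:R :> R.
Proof. by rewrite -natrM; congr (_%:R); rewrite /level expnS; ring. Qed.

Lemma raise_sum n s (i : 'I_D.+2) : (2 <= i)%N ->
  (level n * 4 ^ n)%:R * tail n s 0 i
    <= (level n)%:R * (if (n <= i - 2)%N then 4^-1 ^+ (i - 2 - n) else 0).
Proof.
move=> i2; case: ifP => nc; last first.
  by rewrite tail_lt ?mulr0//; lia.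
rewrite natrM -mulrA ler_pM2l ?level_gt0//.
apply: le_trans (ler_wpM2l _ (tail_le _ _ _)) _ => //.
rewrite natrX -{1}(subnKC nc) exprD mulrA -exprMn mulfV//.
by rewrite expr1n mul1r.
Qed.

(** The two copies and the raise add up to at most [9/8 * level n * decay n]; passing to [n.+1]
    costs at most a factor 2 in the decay, against a gain of 64 in the level. *)
Lemma counter_sum_ge2 n s (i : 'I_D.+2) : (2 <= i)%N ->
  \sum_(v <- counter n s) v 0 i <= (level n)%:R / 16 * decay n (i - 2).
Proof.
move=> i2; elim: n s => [|n IH] s /=.
  apply: (@le_trans _ _ (\sum_(v <- base s) 4^-1 ^+ (i - 2))).
    rewrite big_seq [X in _ <= X]big_seq; apply: ler_sum => v vb.
    exact: base_le vb _ i2.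
  rewrite big_const_seq count_predT iter_addr_0 -[X in X <= _]mulr_natl.
  apply: ler_pM => //.
    rewrite /level expn0 muln1 -mulnA natrM mulrAC mulfV// mul1r ler_nat.
    by apply: leq_trans (size_base s) _; rewrite leq_pmulr.
  by have := @exp4V_decay 0 (i - 2) isT; rewrite subn0.
rewrite !big_cat/= big_nseq iter_addr_0 -[_ *+ (level n * _)]mulr_natl levelS.
have h1 := IH (upd s n true); have h2 := IH (upd s n false).
have h3 := raise_sum n (upd s n true) i2.
have h4 : (if (n <= i - 2)%N then 4^-1 ^+ (i - 2 - n) else 0) <= decay n (i - 2).
  by case: ifP => nc; [exact: exp4V_decay|exact/ltW/decay_gt0].
have h5 := decayS_ge n (i - 2); have h6 := level_gt0 n.
have h7 := decay_gt0 n (i - 2).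
have h8 : (level n)%:R * decay n (i - 2) <= (level n)%:R * (2 * decay n.+1 (i - 2)).
  by rewrite ler_pM2l.
have h9 := ler_wpM2l (ltW h6) h4.
have h10 : 0 <= (level n)%:R * decay n (i - 2) by rewrite mulr_ge0// ltW.
lra.
Qed.

(** Tailored to [quiet_high]: for [c] other than [n], passing from [n.+1] to [n] leaves room for
    [decay n c / 16] from the silenced lower run and, above bit [n], for [4^-1 ^+ (c - n)] from the
    raise. It never exceeds 5/8, which keeps the pull away from 1. *)
Definition budget n c : R :=
  if (c < n)%N then decay n c / 8 else 5 / 8 - 9 / 16 * decay n c.

(* The past [O] exerts little pull on assets 0 and 1 and on every asset whose
   bit is unset, so those assets are close to their initial state. *)
Definition quiet n s O : Prop :=
  {in O, forall v, admissible v} /\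
  forall X, feasible O X ->
    (forall i : 'I_D.+2, (i < 2)%N -> grad O X i <= 2^-1 ^+ n / 8) /\
    (forall i : 'I_D.+2, (2 <= i)%N -> (i - 2 < n)%N || s (i - 2)%N ->
       grad O X i <= budget n (i - 2)).

Lemma budgetS_lt n c : (c < n)%N -> budget n.+1 c + decay n c / 16 <= budget n c.
Proof.
move=> cn; rewrite /budget cn ltnS (ltnW cn) (decayS_lt cn); lra.
Qed.

Lemma budgetS_gt n c : (n < c)%N ->
  budget n.+1 c + (decay n c / 16 + 4^-1 ^+ (c - n)) <= budget n c.
Proof.
move=> nc; rewrite /budget ltnS [(c <= n)%N]leqNgt nc ltnNge (ltnW nc)/= (decayS_gt nc).
have := exp4V_decay_half nc; lra.
Qed.

Lemma budgetS_diag n : budget n.+1 n <= budget n n.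
Proof. by rewrite /budget ltnn ltnSn decaynn decaySnn; lra. Qed.

Lemma budgetS n c : budget n.+1 c <= budget n c.
Proof.
have [cn|nc|->] := ltngtP c n.
- by have := budgetS_lt cn; have := decay_gt0 n c; lra.
- have := budgetS_gt nc; have := decay_gt0 n c.
  by have : 0 <= 4^-1 ^+ (c - n) :> R by []; lra.
- exact: budgetS_diag.
Qed.

Lemma quiet_low n s O : quiet n.+1 s O -> quiet n (upd s n true) O.
Proof.
move=> [Oadm h]; split=> // X /h[h1 h2]; split=> i i2.
  apply: le_trans (h1 _ i2) _; rewrite exprS.
  by have : 0 <= 2^-1 ^+ n :> R by []; lra.
move=> hi; apply: le_trans (budgetS _ _); apply: h2 => //.
move: hi; rewrite /upd; have [->|_] := eqVneq (i - 2)%N n; first by rewrite ltnSn.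
by move=> /orP[/ltnW hi|->]; rewrite ?orbT// ltnS hi.
Qed.

(** * Silencing the past by raising one bit *)

Section Raise.
Variables (n : nat) (s : nat -> bool) (O : seq V).
Hypotheses (nD : (n < D)%N) (Oq : quiet n.+1 s O).

Let P := counter n (upd s n true).
Let r := tail n (upd s n true).
Let Q := nseq (level n * 4 ^ n) r.

Lemma raise_admissible : {in O ++ P ++ Q, forall v, admissible v}.
Proof.
move=> v; rewrite !mem_cat => /or3P[|vP|/nseqP[-> _]].
- by case: Oq => h _; exact: h.
- by apply: counter_admissible vP; exact: ltnW.
- exact: tail_admissible.
Qed.

Let OPadm : {in O ++ P, forall v, admissible v}.
Proof. by move=> v vOP; apply: raise_admissible; rewrite catA mem_cat vOP. Qed.

Let Oadm : {in O, forall v, admissible v}.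
Proof. by case: Oq. Qed.

Let Padm : {in P, forall v, admissible v}.
Proof. by apply: counter_admissible; exact: ltnW. Qed.

(* The raising returns alone must respect the bound [grad <= 1] at asset
   [n + 2], and every return of [counter n] dominates [r] coordinatewise. *)
Lemma raise_dotp X : feasible (O ++ P ++ Q) X -> (level n)%:R <= dotp X r.
Proof.
move=> f; have X0 i := feasible_gt0 i f.
have [_ fQ] : feasible Q X.
  by move: f; rewrite catA; apply: feasible_catr.
have d0 : 0 < dotp X r by apply: dotp_gt0 => //; exact: tail_admissible.
have nD2 : (n.+2 < D.+2)%N by [].
have := fQ (Ordinal nD2); rewrite grad_nseq tail_diag//.
have e : 4 ^+ n * 4^-1 ^+ n = 1 :> R by rewrite -exprMn mulfV// expr1n.
rewrite natrM natrX mulrA -[_ * _ * 4^-1 ^+ n]mulrA e mulr1.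
by rewrite ler_pdivrMr// mul1r.
Qed.

(** The bounds on [O] persist because feasibility restricts to it. [P] is silenced: its returns
    dominate [r], so each is worth at least [level n]. [Q] pulls only on bits from [n] on, and bit
    [n], now set, is exempt. *)
Lemma quiet_high : quiet n (upd s n false) (O ++ P ++ Q).
Proof.
split; first exact: raise_admissible.
move=> X f; have X0 i := feasible_gt0 i f.
have tau := raise_dotp f; have L0 := level_gt0 n.
have d0 : 0 < dotp X r by exact: lt_le_trans tau.
have [h1 h2] : (forall i : 'I_D.+2, (i < 2)%N -> grad O X i <= 2^-1 ^+ n.+1 / 8) /\
    (forall i : 'I_D.+2, (2 <= i)%N -> (i - 2 < n.+1)%N || s (i - 2)%N ->
       grad O X i <= budget n.+1 (i - 2)).
  by case: Oq => _; apply; apply: feasible_catl f => v vPQ;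
    apply: raise_admissible; rewrite mem_cat vPQ orbT.
have gP i : grad P X i <= (\sum_(v <- P) v 0 i) / (level n)%:R.
  apply: grad_le_sum => // v vP; apply: le_trans tau _.
  by apply: ler_dotp => // j; exact: counter_tail vP j.
split=> i i2; rewrite !grad_cat grad_nseq.
  rewrite tail_lt ?mul0r ?mulr0 ?addr0; last by rewrite (leq_trans i2).
  apply: le_trans (lerD (h1 _ i2) (gP i)) _.
  have : (\sum_(v <- P) v 0 i) / (level n)%:R <= 2^-1 ^+ n / 16.
    rewrite ler_pdivrMr//; apply: le_trans (counter_sum_lt2 _ _ i2) _.
    rewrite /level !natrM !natrX.
    have h64 : 2 ^+ n <= 2^-1 ^+ n * 64 ^+ n :> R.
      by rewrite -exprMn; apply: lerXn2r; rewrite ?nnegrE//; lra.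
    have b0 : 0 <= B%:R * Bt%:R :> R by rewrite -natrM.
    have := ler_wpM2l b0 h64; lra.
  by rewrite exprS; lra.
rewrite /upd; case: eqP => [->|/eqP iN hi].
  by rewrite ltnn.
apply: le_trans (lerD (h2 _ i2 _) (lerD (gP i) (lexx _))) _.
  by move: hi => /orP[/ltnW hi|->]; rewrite ?orbT// ltnS hi.
have hP : (\sum_(v <- P) v 0 i) / (level n)%:R <= decay n (i - 2) / 16.
  rewrite ler_pdivrMr//; apply: le_trans (counter_sum_ge2 _ _ i2) _.
  by rewrite le_eqVlt; apply/orP; left; apply/eqP; ring.
have hQ : (level n * 4 ^ n)%:R * (r 0 i / dotp X r)
    <= if (n <= i - 2)%N then 4^-1 ^+ (i - 2 - n) else 0.
  rewrite mulrA ler_pdivrMr//; apply: le_trans (raise_sum _ _ i2) _.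
  by rewrite mulrC ler_wpM2l//; case: ifP.
have [cn|nc|/eqP] := ltngtP (i - 2)%N n; last by rewrite (negPf iN).
  by rewrite leqNgt cn/= in hQ; have := budgetS_lt cn; lra.
by rewrite (ltnW nc) in hQ; have := budgetS_gt nc; lra.
Qed.

End Raise.

Variable g : R.
Hypothesis base_gap :
  forall s O, quiet 0 s O -> g <= total_gap eta O (base s).

(** Both halves start from a quiet past, so each level doubles the gap; the raising rounds
    contribute at least 0. *)
Lemma counter_gap n s O : (n <= D)%N -> quiet n s O ->
  2 ^+ n * g <= total_gap eta O (counter n s).
Proof.
elim: n s O => [|n IH] s O nD Oq; first by rewrite mul1r; exact: base_gap.
rewrite [counter _ _]/= !total_gap_cat -catA exprS -mulrA mulrDl mul1r.
apply: lerD; first by apply: IH; [exact: ltnW|exact: quiet_low].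
rewrite -[X in X <= _]add0r; apply: lerD.
  apply: total_gap_ge0 => //; rewrite -catA; exact: raise_admissible.
by apply: IH; [exact: ltnW|exact: quiet_high].
Qed.

End Counter.

(** * The base run *)

Definition harmonic_sum (R : realType) n : R := \sum_(j < n) j.+1%:R^-1.

(** Each dyadic block, of [2 ^ p] terms, sums to between 1/2 and 1. *)
Lemma harmonic_sum_pow2 (R : realType) p :
  p%:R / 2 <= harmonic_sum R (2 ^ p) <= p.+1%:R.
Proof.
elim: p => [|p /andP[IH1 IH2]].
  by rewrite /harmonic_sum expn0 big_ord1 invr1; apply/andP; split; lra.
have E : harmonic_sum R (2 ^ p.+1) = harmonic_sum R (2 ^ p)
    + \sum_(j < 2 ^ p) (2 ^ p + j).+1%:R^-1.
  by rewrite /harmonic_sum expnS mul2n -addnn big_split_ord.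
have pp : 0 < (2 ^ p)%:R :> R by rewrite ltr0n expn_gt0.
have lo : 2^-1 <= \sum_(j < 2 ^ p) (2 ^ p + j).+1%:R^-1 :> R.
  rewrite [X in X <= _](_ : _ = \sum_(j < 2 ^ p) (2 * (2 ^ p)%:R)^-1).
    apply: ler_sum => j _; rewrite lef_pV2 ?posrE ?mulr_gt0 ?ltr0n ?expn_gt0//.
    by rewrite -natrM ler_nat; have := ltn_ord j; lia.
  by rewrite sumr_const card_ord -[RHS]mulr_natl invfM mulrCA mulfV ?mulr1// gt_eqF.
have hi : \sum_(j < 2 ^ p) (2 ^ p + j).+1%:R^-1 <= 1 :> R.
  rewrite [X in _ <= X](_ : _ = \sum_(j < 2 ^ p) (2 ^ p)%:R^-1).
    apply: ler_sum => j _; rewrite lef_pV2 ?posrE ?ltr0n ?expn_gt0//.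
    by rewrite ler_nat; lia.
  by rewrite sumr_const card_ord -[RHS]mulr_natl mulfV// gt_eqF.
rewrite E -(natr1 p.+1) -(natr1 p); apply/andP; split; last by move: IH2; rewrite -natr1; lra.
by lra.
Qed.

Lemma geometric_sum4 (R : realType) n : \sum_(c < n) 4^-1 ^+ c <= 4 / 3 :> R.
Proof.
have -> : \sum_(c < n) 4^-1 ^+ c = 4 / 3 * (1 - 4^-1 ^+ n) :> R.
  elim: n => [|n IH]; first by rewrite big_ord0 subrr mulr0.
  by rewrite big_ord_recr/= IH exprS; lra.
have : 0 <= 4^-1 ^+ n :> R by []; lra.
Qed.

(** * Parameters and returns of the base run *)

Section BaseRun.
Variables (R : realType) (D : nat) (eta : R).
Hypothesis eta_gt0 : 0 < eta.
Notation V := 'rV[R]_D.+2.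
Implicit Types (H O P : seq V) (X v : V) (s : nat -> bool).

Variables (E p K : nat).
Hypotheses (E_gt0 : (0 < E)%N) (K_gt0 : (0 < K)%N).
Hypotheses (le_etaE : eta <= E%:R) (le_etaVE : eta^-1 <= E%:R).

(** Number of returns raising asset 1 in phase [k]. The ratio [128 * p.+1] beats the harmonic sums
    of earlier phases ([play_upper]); the prefactor beats [E ^ 2], [E * 2 ^ p] and [K * 2 ^ p]. *)
Definition stock k : nat := 80 * E ^ 2 * K * 2 ^ p * (128 * p.+1) ^ k.
Definition run_bound : nat := 2 * stock K.
(** Large enough for the whole base run to pull at most 1/16 on each bit asset
    ([state_killer_grad]). *)
Definition base_weight : nat := 16 * run_bound * E.
Local Notation B := run_bound.
Local Notation Bt := base_weight.

Definition asset0 : 'I_D.+2 := ord0.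
Definition asset1 : 'I_D.+2 := lift ord0 ord0.

(** The tail is what lets a later raise of an unset bit silence this return. *)
Definition base_play (a0 a1 : R) s : V :=
  \row_(i < D.+2) (if i == asset0 then Bt%:R * a0 else
                   if i == asset1 then Bt%:R * a1 else tail R D 0 s 0 i).

(** The bound of [gap_ge] with [sg = 1 / (5E)] and [X_0 + 1 <= 3 * E * (j + 1)], leaving out the
    factor [j + 1]. *)
Definition unit_gap : R := ((5 * E%:R) ^+ 2 * (96 * E%:R))^-1.

(* During phase [k] asset 1 is worth between [stock k / 2] and [4 * stock k], so
   round [i] puts on it a value proportional to [i + 1], as on asset 0: weak
   enough not to spoil the gap, strong enough to be silenced by the next phase. *)
Definition plays k s j : seq V :=
  [seq base_play 1 (i.+1%:R / (8 * (stock k)%:R)) s | i <- iota 0 j].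

Definition phase k s : seq V := nseq (stock k) (base_play 0 1 s) ++ plays k s (2 ^ p).

Fixpoint phases k s : seq V :=
  if k is k'.+1 then phases k' s ++ phase k' s else [::].

Lemma stock_gt0 k : (0 < stock k)%N.
Proof. by rewrite /stock !muln_gt0 !expn_gt0 E_gt0 K_gt0. Qed.

Lemma run_bound_gt0 : (0 < B)%N.
Proof. by rewrite muln_gt0 stock_gt0. Qed.

Lemma base_weight_gt0 : (0 < Bt)%N.
Proof. by rewrite muln_gt0 muln_gt0 run_bound_gt0 E_gt0. Qed.

Lemma dotp_base_play a0 a1 s X : dotp X (base_play a0 a1 s) =
  Bt%:R * (a0 * X 0 asset0 + a1 * X 0 asset1) + dotp X (tail R D 0 s).
Proof.
rewrite /dotp !big_ord_recl/= !mxE/=.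
under eq_bigr => i _ do rewrite mxE/=.
rewrite /asset0 /asset1; ring.
Qed.

Definition is_base_play s v : Prop := exists a0 a1 : R,
  [/\ 0 <= a0 <= 1, 0 <= a1 <= 1, a0 = 1 \/ a1 = 1 & v = base_play a0 a1 s].

Lemma leq_m_stock k : (2 ^ p <= stock k)%N.
Proof.
rewrite /stock -mulnA mulnC -mulnA leq_pmulr//.
by rewrite !muln_gt0 !expn_gt0 E_gt0 K_gt0.
Qed.

Lemma plays_is_base_play k s j v : (j <= 2 ^ p)%N -> v \in plays k s j ->
  is_base_play s v.
Proof.
move=> jm /mapP[i]; rewrite mem_iota add0n => /andP[_ ij] ->.
exists 1, (i.+1%:R / (8 * (stock k)%:R)).
have s0 : 0 < (stock k)%:R :> R by rewrite ltr0n stock_gt0.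
split=> //; [by rewrite ler01 lexx| |by left].
rewrite divr_ge0 ?mulr_ge0 ?(ltW s0)//= ler_pdivrMr ?mulr_gt0// mul1r.
have : i.+1%:R <= (stock k)%:R :> R.
  by rewrite ler_nat (leq_trans ij)// (leq_trans jm)// leq_m_stock.
by move: s0; lra.
Qed.

Lemma stock_play_is_base_play s : is_base_play s (base_play 0 1 s).
Proof. by exists 0, 1; split=> //; rewrite ?lexx ?ler01//; right. Qed.

Lemma phases_is_base_play k s v : v \in phases k s -> is_base_play s v.
Proof.
elim: k => //= k IH; rewrite !mem_cat => /orP[/IH//|/orP[/nseqP[-> _]|]].
  exact: stock_play_is_base_play.
exact: plays_is_base_play.
Qed.

Lemma base_play_killer a0 a1 s (i : 'I_D.+2) : (2 <= i)%N ->
  base_play a0 a1 s 0 i = tail R D 0 s 0 i.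
Proof.
move=> i2; rewrite mxE.
by rewrite -(inj_eq val_inj) -[i == asset1](inj_eq val_inj)/=; case: (i : nat) i2 => [|[]].
Qed.

Lemma is_base_play_admissible s v : is_base_play s v -> admissible v.
Proof.
move=> [a0 [a1 [/andP[a00 _] /andP[a10 _] h ->]]].
have Bt0 : 0 < Bt%:R :> R by rewrite ltr0n base_weight_gt0.
split=> [i|].
  rewrite mxE; case: ifP => _; first by rewrite mulr_ge0// ltW.
  by case: ifP => _; [rewrite mulr_ge0// ltW|exact: tail_ge0].
by case: h => ->; [exists asset0|exists asset1]; rewrite mxE/= mulr1.
Qed.

Lemma is_base_play_tail s v i : is_base_play s v -> tail R D 0 s 0 i <= v 0 i.
Proof.
move=> vb; have [i2|i2] := leqP 2 i.
  by case: vb => a0 [a1 [_ _ _ ->]]; rewrite base_play_killer.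
by rewrite tail_lt//; case: (is_base_play_admissible vb).
Qed.

Lemma is_base_play_le_Bt s v (i : 'I_D.+2) : is_base_play s v -> (i < 2)%N ->
  v 0 i <= Bt%:R.
Proof.
move=> [a0 [a1 [/andP[_ h0] /andP[_ h1] _ ->]]] i2; rewrite mxE.
case: ifP => [_|]; first by rewrite ger_pMr// ltr0n base_weight_gt0.
case: ifP => [_ _|]; first by rewrite ger_pMr// ltr0n base_weight_gt0.
by rewrite -(inj_eq val_inj) -[i == asset0](inj_eq val_inj)/=; case: (i : nat) i2 => [|[]].
Qed.

Lemma is_base_play_le s v (i : 'I_D.+2) : is_base_play s v -> (2 <= i)%N ->
  v 0 i <= 4^-1 ^+ (i - 2).
Proof.
by move=> [a0 [a1 [_ _ _ ->]]] i2; rewrite base_play_killer// tail_le.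
Qed.

(** * Length of the base run *)

Definition stock_sum k : nat := \sum_(i < k) stock i.

Lemma size_phases k s : size (phases k s) = (stock_sum k + k * 2 ^ p)%N.
Proof.
rewrite /stock_sum; elim: k => [|k IH] /=; first by rewrite big_ord0.
by rewrite !size_cat size_nseq size_map size_iota IH big_ord_recr/= mulSn; lia.
Qed.

Lemma stock_sum_le k : (stock_sum k * (128 * p.+1) <= 2 * stock k)%N.
Proof.
rewrite /stock_sum; elim: k => [|k IH]; first by rewrite big_ord0.
rewrite big_ord_recr/= mulnDl.
have -> : stock k.+1 = (stock k * (128 * p.+1))%N by rewrite /stock (expnSr _ k) mulnA.
have c2 : (2 <= 128 * p.+1)%N by lia.
have := leq_mul (leqnn (stock k)) c2; move: IH {c2}.
by move: (128 * _)%N (stock k) (\sum_(i < k) _)%N => c a S; lia.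
Qed.

Lemma Km_le_stock k : (80 * E ^ 2 * (K * 2 ^ p) <= stock k)%N.
Proof. by rewrite /stock !mulnA leq_pmulr// expn_gt0. Qed.

Lemma size_phases_le k s : (k <= K)%N ->
  (size (phases k s) + stock k <= 2 * stock k + K * 2 ^ p)%N.
Proof.
move=> kK; rewrite size_phases.
have h1 : (stock_sum k <= stock k)%N by have := stock_sum_le k; nia.
have h2 : (k * 2 ^ p <= K * 2 ^ p)%N by rewrite leq_mul2r kK orbT.
by lia.
Qed.

Lemma size_base_run s : (size (phases K s) <= B)%N.
Proof.
have := size_phases_le s (leqnn K); have := Km_le_stock K; rewrite /run_bound.
have : (0 < E ^ 2)%N by rewrite expn_gt0 E_gt0.
nia.
Qed.

Let Bt_gt0 : 0 < Bt%:R :> R.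
Proof. by rewrite ltr0n base_weight_gt0. Qed.

Lemma base_play_dotp_ge X s v : is_base_play s v -> (forall i, eta^-1 <= X 0 i) ->
  Bt%:R / eta <= dotp X v.
Proof.
move=> [a0 [a1 [/andP[a00 _] /andP[a10 _] h ->]]] hX.
have e0 : 0 < eta^-1 by rewrite invr_gt0.
have X0 i : 0 <= X 0 i by apply: le_trans (hX i); exact: ltW.
rewrite dotp_base_play -[X in X <= _]addr0; apply: lerD; last first.
  by apply: sumr_ge0 => i _; rewrite mulr_ge0// tail_ge0.
rewrite ler_pM2l//; have := hX asset0; have := hX asset1.
have := X0 asset0; have := X0 asset1.
by case: h => ->; nra.
Qed.

Lemma mul_grad_le_size P X i : {in P, forall v, admissible v} ->
  (forall i, 0 < X 0 i) -> X 0 i * grad P X i <= (size P)%:R.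
Proof.
move=> Padm X0; rewrite /grad mulr_sumr.
have -> : (size P)%:R = \sum_(v <- P) 1 :> R.
  by rewrite big_const_seq count_predT iter_addr_0.
rewrite big_seq [X in _ <= X]big_seq; apply: ler_sum => v vP.
have /andP[_] := share_itv i X0 (Padm _ vP).
by rewrite /share mulrA [X 0 i * _]mulrC.
Qed.

(** * The rescaled play during the base run *)

Section State.
Variables (s : nat -> bool) (O P : seq V).
Hypotheses (Oq : quiet eta 0 s O) (Pbase : {in P, forall v, is_base_play s v}).
Hypothesis size_P : (size P <= B)%N.

Let X := scaled_play eta (O ++ P).
(** Value of the tail in units of [Bt]; the lemmas below keep it under 3/8. *)
Let zeta := dotp X (tail R D 0 s) / Bt%:R.

Lemma state_base_admissible : {in P, forall v, admissible v}.
Proof. by move=> v /Pbase/is_base_play_admissible. Qed.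

Lemma state_admissible : {in O ++ P, forall v, admissible v}.
Proof.
move=> v; rewrite mem_cat => /orP[|/state_base_admissible//].
by case: Oq => h _; exact: h.
Qed.

Lemma state_feasible : feasible eta (O ++ P) X.
Proof. exact: scaled_play_feasible state_admissible. Qed.

Lemma state_feasibleO : feasible eta O X.
Proof. exact: feasible_catl state_base_admissible state_feasible. Qed.

Lemma state_feasibleP : feasible eta P X.
Proof. by apply: feasible_catr state_feasible => //; case: Oq. Qed.

Lemma state_gt0 i : 0 < X 0 i.
Proof. exact: feasible_gt0 state_feasible. Qed.

Lemma state_ge i : eta^-1 <= X 0 i.
Proof. by case: state_feasible. Qed.

Lemma state_eq i : X 0 i * (1 - grad O X i - grad P X i) = eta^-1.
Proof.
by rewrite -(scaled_play_grad eta_gt0 i state_admissible) grad_cat opprD addrA.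
Qed.

(** At most [B] returns put at most 1 each on a bit asset, while each is worth at least
    [Bt / eta]. *)
Lemma state_killer_grad (i : 'I_D.+2) : (2 <= i)%N -> grad P X i <= 16^-1.
Proof.
move=> i2.
have BR : 0 < B%:R :> R by rewrite ltr0n run_bound_gt0.
have tau0 : 0 < Bt%:R / eta by rewrite divr_gt0.
have h v : v \in P -> Bt%:R / eta <= dotp X v.
  by move=> vP; apply: base_play_dotp_ge (Pbase vP) _; exact: state_ge.
apply: le_trans (grad_le_sum i state_base_admissible tau0 h) _.
rewrite ler_pdivrMr//.
have : \sum_(v <- P) v 0 i <= B%:R.
  apply: (@le_trans _ _ (\sum_(v <- P) 1)).
    rewrite big_seq [X in _ <= X]big_seq; apply: ler_sum => v vP.
    apply: le_trans (is_base_play_le (Pbase vP) i2) _.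
    by rewrite exprn_ile1 ?invr_ge0 ?invf_le1//; lra.
  by rewrite big_const_seq count_predT iter_addr_0 ler_nat.
move/le_trans; apply; rewrite mulrA ler_pdivlMr// /base_weight natrM natrM.
have := ler_wpM2l (ltW BR) le_etaE; lra.
Qed.

(** The past pulls at most 5/8 and the base run at most 1/16, which leaves a factor 5/16 in the
    stationarity equation. *)
Lemma state_killer_le (i : 'I_D.+2) : (2 <= i)%N -> s (i - 2)%N -> X 0 i <= 4 / eta.
Proof.
move=> i2 si; have := state_eq i; have := state_killer_grad i2.
have [_ /(_ X state_feasibleO)[_ /(_ i i2)]] := Oq.
rewrite si/= => /(_ isT); rewrite /budget /decay ltn0 sub0n subn0 add0n => h1 h2 h3.
have e : 0 <= 2^-1 ^+ (i - 2) :> R by [].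
have X0 := state_gt0 i.
have : X 0 i * (5 / 16) <= eta^-1 by rewrite -h3 ler_pM2l//; lra.
have : 0 < eta^-1 by rewrite invr_gt0.
lra.
Qed.

Lemma state_tail_le : dotp X (tail R D 0 s) <= 6 / eta.
Proof.
have e0 : 0 < eta^-1 by rewrite invr_gt0.
rewrite /dotp !big_ord_recl/= !tail_lt// !mulr0 !add0r.
apply: (@le_trans _ _ (\sum_(c < D) 4 / eta * 4^-1 ^+ c)).
  apply: ler_sum => c _; set i := lift _ _.
  have iE : i = c.+2 :> nat by [].
  rewrite [tail _ _ _ _ _ _]mxE iE subSS subSS subn0 ltnS ltnS leq0n/=.
  case: ifP => sc; last first.
    by rewrite mulr0 mulr_ge0// mulr_ge0// ltW.
  apply: ler_wpM2r => //; apply: state_killer_le; first by rewrite iE.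
  by rewrite iE subSS subSS subn0.
rewrite -mulr_sumr.
have := @ler_wpM2l _ (4 / eta) _ _ _ (geometric_sum4 R D).
have h : 0 <= 4 / eta by lra.
by move=> /(_ h); lra.
Qed.

Lemma zeta_ge0 : 0 <= zeta.
Proof.
rewrite divr_ge0 ?(ltW Bt_gt0)//; apply: sumr_ge0 => i _.
by rewrite mulr_ge0 ?tail_ge0// ltW// state_gt0.
Qed.

Lemma zeta_le_etaV : zeta <= 3 / 8 / eta.
Proof.
rewrite ler_pdivrMr//; apply: le_trans state_tail_le _.
have e0 : 0 < eta^-1 by rewrite invr_gt0.
have : 16 <= Bt%:R :> R.
  by rewrite ler_nat /base_weight -mulnA leq_pmulr// muln_gt0 run_bound_gt0 E_gt0.
nra.
Qed.

Lemma zeta_le : zeta <= 3 / 8.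
Proof.
rewrite ler_pdivrMr//; apply: le_trans state_tail_le _.
have : 16 * E%:R <= Bt%:R :> R.
  by rewrite -natrM ler_nat /base_weight leq_mul2r leq_pmulr ?orbT// run_bound_gt0.
move: le_etaVE; lra.
Qed.

Lemma state_dotp a0 a1 :
  dotp X (base_play a0 a1 s) = Bt%:R * (a0 * X 0 asset0 + a1 * X 0 asset1 + zeta).
Proof.
by rewrite dotp_base_play [RHS]mulrDr /zeta mulrCA mulfV ?mulr1// gt_eqF.
Qed.

Lemma base_play_i0 a0 a1 : base_play a0 a1 s 0 asset0 = Bt%:R * a0.
Proof. by rewrite mxE. Qed.

Lemma base_play_i1 a0 a1 : base_play a0 a1 s 0 asset1 = Bt%:R * a1.
Proof. by rewrite mxE. Qed.

Lemma state_ratio (i : 'I_D.+2) a0 a1 a : base_play a0 a1 s 0 i = Bt%:R * a ->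
  base_play a0 a1 s 0 i / dotp X (base_play a0 a1 s)
    = a / (a0 * X 0 asset0 + a1 * X 0 asset1 + zeta).
Proof.
by move=> ->; rewrite state_dotp invfM mulrACA mulfV ?mul1r// gt_eqF.
Qed.

Lemma grad_plays k j : grad (plays k s j) X asset0 =
  \sum_(i < j) (X 0 asset0 + i.+1%:R / (8 * (stock k)%:R) * X 0 asset1 + zeta)^-1.
Proof.
rewrite /grad /plays big_map -[X in iota 0 X]subn0 big_mkord; apply: eq_bigr => i _.
by rewrite (state_ratio (a := 1)) ?base_play_i0// !mul1r.
Qed.

(** Only the asset 1 part of the value of each harmonic return is kept; stock returns have weight 0
    on asset 0. *)
Lemma grad_phases k : grad (phases k s) X asset0 <=
  8 * (stock_sum k)%:R * harmonic_sum R (2 ^ p) / X 0 asset1.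
Proof.
have Y0 := state_gt0 asset0; have X1 := state_gt0 asset1; have z0 := zeta_ge0.
elim: k => [|k IH] /=.
  by rewrite /grad big_nil /stock_sum big_ord0 mulr0 !mul0r.
have S0 : 0 < (stock k)%:R :> R by rewrite ltr0n stock_gt0.
rewrite !grad_cat grad_nseq (state_ratio (a := 0)) ?base_play_i0// mul0r mulr0 add0r.
have -> : stock_sum k.+1 = (stock_sum k + stock k)%N by rewrite /stock_sum big_ord_recr.
rewrite natrD mulrDr mulrDl mulrDl lerD// grad_plays /harmonic_sum.
rewrite -mulrA [_ / _]mulrC mulrA mulr_sumr; apply: ler_sum => i _.
have j_gt0 : 0 < i.+1%:R :> R by rewrite ltr0n.
have -> : 8 * (stock k)%:R * (X 0 asset1)^-1 * i.+1%:R^-1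
    = (i.+1%:R / (8 * (stock k)%:R) * X 0 asset1)^-1.
  by field; rewrite !gt_eqF.
have e0 : 0 < i.+1%:R / (8 * (stock k)%:R) * X 0 asset1.
  by rewrite mulr_gt0// divr_gt0// mulr_gt0.
by rewrite lef_pV2 ?posrE//; lra.
Qed.

End State.

(** * A single harmonic round *)

Section Play.
Variables (s : nat -> bool) (O : seq V) (k j : nat).
Hypotheses (Oq : quiet eta 0 s O) (kK : (k < K)%N) (jm : (j < 2 ^ p)%N).

Let P := phases k s ++ nseq (stock k) (base_play 0 1 s) ++ plays k s j.
Let X := scaled_play eta (O ++ P).
Let Y := X 0 asset0.
Let X1 := X 0 asset1.
Let A : R := (stock k)%:R.
Let zeta := dotp X (tail R D 0 s) / Bt%:R.

Let Pbase : {in P, forall v, is_base_play s v}.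
Proof.
move=> v; rewrite !mem_cat => /or3P[|/nseqP[-> _]|].
- exact: phases_is_base_play.
- exact: stock_play_is_base_play.
- by apply: plays_is_base_play; exact: ltnW.
Qed.

Lemma size_play_history : (size P <= 2 * stock k + K * 2 ^ p + 2 ^ p)%N.
Proof.
rewrite !size_cat size_nseq size_map size_iota addnA.
by rewrite leq_add ?(ltnW jm)// size_phases_le// ltnW.
Qed.

Let size_P : (size P <= B)%N.
Proof.
apply: leq_trans size_play_history _.
have h1 : (K * 2 ^ p <= stock k)%N.
  by apply: leq_trans (Km_le_stock k); rewrite leq_pmull// muln_gt0 expn_gt0 E_gt0.
have h2 := leq_m_stock k.
have h3 : (stock k * (128 * p.+1) <= stock K)%N.
  rewrite /stock -mulnA -expnSr leq_mul2l leq_exp2l ?kK ?orbT//; lia.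
have h4 : (stock k * 128 <= stock k * (128 * p.+1))%N.
  by rewrite leq_mul2l leq_pmulr// orbT.
rewrite /run_bound; lia.
Qed.

Let Padm : {in P, forall v, admissible v}.
Proof. by move=> v /Pbase/is_base_play_admissible. Qed.

Let X_gt0 i : 0 < X 0 i. Proof. exact: state_gt0 Oq Pbase i. Qed.

Let A_gt0 : 0 < A. Proof. by rewrite ltr0n stock_gt0. Qed.

Let A_ge_E : 40 * E%:R <= A.
Proof.
rewrite -natrM ler_nat; apply: leq_trans (Km_le_stock k).
have : (0 < K * 2 ^ p)%N by rewrite muln_gt0 K_gt0 expn_gt0.
move: (K * _)%N => c c0.
have : (E <= E * (E * c))%N by rewrite leq_pmulr// muln_gt0 E_gt0.
by rewrite -mulnn; lia.
Qed.

Let A_ge_Km : 40 * (K * 2 ^ p)%:R <= A.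
Proof.
rewrite -natrM ler_nat; apply: leq_trans (Km_le_stock k).
have : (0 < E ^ 2)%N by rewrite expn_gt0 E_gt0.
by move: (K * _)%N (E ^ 2)%N => c e e0; nia.
Qed.

Let A_ge : 40 * E%:R * (E%:R + (2 ^ p)%:R) <= A.
Proof.
rewrite -natrD -!natrM ler_nat; apply: leq_trans (Km_le_stock k).
have m0 : (0 < 2 ^ p)%N by rewrite expn_gt0.
have h : (E * E <= E * E * (2 ^ p))%N by rewrite leq_pmulr.
have h' : (E * (2 ^ p) <= E * E * (2 ^ p))%N by rewrite leq_mul2r leq_pmulr ?orbT.
have h'' : (E * E * (2 ^ p) <= E * E * (K * 2 ^ p))%N by rewrite leq_mul2l leq_pmull ?orbT.
rewrite -mulnn; lia.
Qed.

Let gradO (i : 'I_D.+2) : (i < 2)%N -> grad O X i <= 8^-1.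
Proof.
move=> i2; have [_ /(_ X (state_feasibleO Oq Pbase))[/(_ i i2) h _]] := Oq.
by move: h; rewrite expr0 div1r.
Qed.

Let zeta0 : 0 <= zeta. Proof. exact: zeta_ge0 Oq Pbase. Qed.
Let zeta1 : zeta <= 3 / 8. Proof. exact: zeta_le Oq Pbase size_P. Qed.
Let zetaY : zeta <= 3 / 8 * Y.
Proof.
apply: le_trans (zeta_le_etaV Oq Pbase size_P) _.
by rewrite ler_pM2l//; exact: state_ge Oq Pbase asset0.
Qed.

Let feasP : feasible eta P X. Proof. exact: state_feasibleP Oq Pbase. Qed.

(** Feasibility for the [A] stock returns of this phase gives [A <= X1 + zeta]. *)
Lemma stock_lower : A / 2 <= X1.
Proof.
have [_ /(_ asset1)] := feasP; rewrite !grad_cat grad_nseq.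
rewrite (state_ratio O P (a := 1)) ?base_play_i1// mul0r add0r !mul1r -/X1 -/zeta.
have ph0 : 0 <= grad (phases k s) X asset1.
  by apply: grad_ge0 => // v vP; apply: Padm; rewrite mem_cat vP.
have pl0 : 0 <= grad (plays k s j) X asset1.
  by apply: grad_ge0 => // v vP; apply: Padm; rewrite !mem_cat vP !orbT.
move=> h; have {h} : A / (X1 + zeta) <= 1 by rewrite /A; lra.
have X10 : 0 < X1 by exact: X_gt0.
rewrite ler_pdivrMr ?mul1r ?ltr_pwDl// => h.
have E1 : 1 <= E%:R :> R by rewrite ler1n.
by move: A_ge_E zeta1; lra.
Qed.

(** Shares are at most 1, so stationarity gives [7/8 * X1 <= eta^-1 + size P], and [size P] is at
    most [2 * A] plus lower-order terms. *)
Lemma stock_upper : X1 <= 4 * A.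
Proof.
have := state_eq Oq Pbase asset1; rewrite -/X -/X1.
have := mul_grad_le_size asset1 Padm X_gt0; rewrite -/X1.
have := gradO (erefl _ : (asset1 < 2)%N).
have X10 : 0 < X1 by exact: X_gt0.
move: le_etaVE; set g := grad O X asset1; set gP := grad P X asset1 => h1 h2 h3 h4.
have h5 : (size P)%:R <= 2 * A + 2 * (K * 2 ^ p)%:R.
  rewrite -!natrM -natrD ler_nat; apply: leq_trans size_play_history _.
  by rewrite -addnA leq_add2l mul2n -addnn leq_add2l leq_pmull.
have h6 : X1 * g <= X1 * 8^-1 by rewrite ler_pM2l.
by move: A_ge_Km A_ge_E; lra.
Qed.

(** In units of [Bt], asset 1 adds at most [j / 2] to the value of each of the [j] earlier rounds of
    this phase, so each pulls at least [1 / (Y + j / 2 + zeta)] on asset 0. *)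
Lemma play_lower : j%:R / 2 - zeta <= Y.
Proof.
have Y0 : 0 < Y by exact: X_gt0.
have [j0|j0] := posnP j.
  have -> : j%:R = 0 :> R by rewrite j0.
  by move: zeta0; lra.
have [_ /(_ asset0)] := feasP; rewrite !grad_cat grad_nseq.
rewrite (state_ratio O P (a := 0)) ?base_play_i0// mul0r mulr0 add0r.
have ph0 : 0 <= grad (phases k s) X asset0.
  by apply: grad_ge0 => // v vP; apply: Padm; rewrite mem_cat vP.
rewrite (grad_plays s O P) -/Y -/X1 -/zeta => h.
have {h ph0} h : \sum_(i < j) (Y + i.+1%:R / (8 * (stock k)%:R) * X1 + zeta)^-1 <= 1 by lra.
have X10 : 0 < X1 by exact: X_gt0.
have j0R : 0 < j%:R :> R by rewrite ltr0n.
have d0 : 0 < Y + j%:R / 2 + zeta by move: zeta0; lra.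
have : j%:R / (Y + j%:R / 2 + zeta) <= 1.
  apply: le_trans h; rewrite -[j in j%:R / _]card_ord.
  rewrite mulr_natl -sumr_const; apply: ler_sum => i _.
  have i0R : 0 < i.+1%:R :> R by rewrite ltr0n.
  have e0 : 0 < i.+1%:R / (8 * (stock k)%:R) * X1.
    by rewrite mulr_gt0// divr_gt0// mulr_gt0.
  rewrite lef_pV2 ?posrE//; last by move: zeta0; lra.
  rewrite lerD2r lerD2l mulrAC ler_pdivrMr ?mulr_gt0//.
  have ij : i.+1%:R <= j%:R :> R by rewrite ler_nat.
  apply: (@le_trans _ _ (j%:R * (4 * A))).
    by apply: ler_pM => //; [exact: ltW|exact: stock_upper].
  by rewrite -/A; lra.
rewrite ler_pdivrMr// mul1r; lra.
Qed.

(** The past and the earlier phases pull at most 1/8 and 1/4 on asset 0; the [j] rounds of this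
    phase contribute shares of at most 1. *)
Lemma play_upper : Y <= 2 * (E%:R + j%:R).
Proof.
have := state_eq Oq Pbase asset0; rewrite -/X -/Y.
have := gradO (erefl _ : (asset0 < 2)%N).
have Y0 : 0 < Y by exact: X_gt0.
have X10 : 0 < X1 by exact: X_gt0.
set g := grad O X asset0 => g8.
rewrite !grad_cat grad_nseq (state_ratio O P (a := 0)) ?base_play_i0// mul0r mulr0 add0r.
have pl : Y * grad (plays k s j) X asset0 <= j%:R.
  rewrite -[j in X in _ <= X](_ : size (plays k s j) = j); last by rewrite size_map size_iota.
  apply: mul_grad_le_size => // v vP; apply: Padm; by rewrite !mem_cat vP !orbT.
have ph : grad (phases k s) X asset0 <= 4^-1.
  apply: le_trans (grad_phases Oq Pbase k) _; rewrite -/X1.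
  rewrite ler_pdivrMr//.
  have /andP[_ hh] := harmonic_sum_pow2 R p.
  have S : (stock_sum k)%:R * (128 * p.+1%:R) <= 2 * A :> R.
    by rewrite -!natrM ler_nat stock_sum_le.
  have S0 : 0 <= (stock_sum k)%:R :> R by [].
  have := ler_wpM2l S0 hh; have := stock_lower; lra.
set gp := grad _ _ _ in ph *; set gl := grad _ _ _ in pl *.
have h1 : Y * g <= Y * 8^-1 by rewrite ler_pM2l.
have h2 : Y * gp <= Y * 4^-1 by rewrite ler_pM2l.
by move: le_etaVE; have j0 : 0 <= j%:R :> R by []; lra.
Qed.

Let eps : R := j.+1%:R / (8 * (stock k)%:R).

(** In the value [Y + eps * X1 + zeta] the middle term is at most [(j + 1) / 2], which [play_lower]
    and [1 <= E * Y] bound by a multiple of [E * Y]. *)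
Lemma play_share : (5 * E%:R)^-1 <= share X (base_play 1 eps s) asset0.
Proof.
have Y0 : 0 < Y by exact: X_gt0.
have X10 : 0 < X1 by exact: X_gt0.
have E1 : 1 <= E%:R :> R by rewrite ler1n.
have j0 : 0 <= j%:R :> R by [].
have -> : share X (base_play 1 eps s) asset0 = Y / (Y + eps * X1 + zeta).
  rewrite /share mulrAC (state_ratio O P (a := 1)) ?base_play_i0//.
  by rewrite !mul1r mulrC.
have hX : eps * X1 <= j.+1%:R / 2.
  rewrite /eps mulrAC ler_pdivrMr ?mulr_gt0//.
  by apply: le_trans (ler_wpM2l _ stock_upper) _ => //; rewrite -/A; lra.
have e0 : 0 <= eps * X1 by rewrite mulr_ge0 ?(ltW X10)// divr_ge0// mulr_ge0.
have d0 : 0 < Y + eps * X1 + zeta by move: zeta0; lra.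
rewrite ler_pdivlMr// ler_pdivrMl ?mulr_gt0//; last by lra.
have EY : 1 <= E%:R * Y.
  have h : eta^-1 <= Y by exact: state_ge Oq Pbase asset0.
  have h' : 1 <= E%:R * eta^-1 by rewrite ler_pdivlMr// mul1r.
  by apply: le_trans h' _; rewrite ler_pM2l//; lra.
have YE : Y <= E%:R * Y by rewrite ler_peMl// ltW.
move: hX; rewrite -natr1 => hX.
by have := play_lower; move: zetaY; lra.
Qed.

(** Asset 1 alone suffices: [10 * E * Y <= A / 2 <= X1]. *)
Lemma play_small : Y <= (5 * E%:R)^-1 / 2 * \sum_i X 0 i.
Proof.
have E1 : 1 <= E%:R :> R by rewrite ler1n.
have E0 : 0 < E%:R :> R by lra.
have S : X1 <= \sum_i X 0 i.
  rewrite (bigD1 asset1)//= lerDl sumr_ge0// => i _; exact: ltW.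
have jm' : j%:R <= (2 ^ p)%:R :> R by rewrite ler_nat ltnW.
have h : E%:R * Y <= E%:R * (2 * (E%:R + (2 ^ p)%:R)).
  by rewrite ler_pM2l//; have := play_upper; lra.
rewrite -invfM ler_pdivlMl ?mulr_gt0//.
by have := stock_lower; move: A_ge; lra.
Qed.

Lemma play_gap :
  unit_gap / j.+1%:R <= gap eta (O ++ P) (base_play 1 eps s).
Proof.
have E1 : 1 <= E%:R :> R by rewrite ler1n.
have E0 : 0 < E%:R :> R by lra.
have Y0 : 0 < Y by exact: X_gt0.
have j0 : 0 <= j%:R :> R by [].
have va : admissible (base_play 1 eps s).
  apply: (@is_base_play_admissible s).
  apply: (@plays_is_base_play k s j.+1) => //.
  by apply/mapP; exists j => //; rewrite mem_iota /= add0n.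
have sg0 : 0 < (5 * E%:R)^-1 :> R by rewrite invr_gt0 mulr_gt0.
have sg1 : (5 * E%:R)^-1 <= 1 :> R by rewrite invf_le1 ?mulr_gt0//; lra.
have sg := introT andP (conj sg0 sg1).
apply: le_trans 
  (@gap_ge R _ eta eta_gt0 _ _ asset0 _ (state_admissible Oq Pbase) va sg
    play_share play_small).
have p3 : 0 < (5 * E%:R) ^+ 2 :> R by apply: exprn_gt0; exact: mulr_gt0.
have p4 : 0 < 32 * (Y + 1) by apply: mulr_gt0 => //; lra.
have p5 : 0 < 96 * E%:R * j.+1%:R :> R by rewrite mulr_gt0// mulr_gt0.
rewrite -/X -/Y /unit_gap -invfM exprVn -invfM -mulrA.
rewrite lef_pV2 ?posrE ?(mulr_gt0 p3)// (ler_pM2l p3) -natr1.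
have := play_upper; have := ler_wpM2r j0 E1; lra.
Qed.

End Play.

(** * Gap of the base run and of the full adversary *)

Lemma unit_gap_gt0 : 0 < unit_gap.
Proof.
have E0 : 0 < E%:R :> R by rewrite ltr0n.
rewrite /unit_gap invr_gt0; apply: mulr_gt0; last exact: mulr_gt0.
by apply: exprn_gt0; exact: mulr_gt0.
Qed.

Lemma plays_gap s O k j : quiet eta 0 s O -> (k < K)%N -> (j <= 2 ^ p)%N ->
  unit_gap * harmonic_sum R j <=
  total_gap eta (O ++ phases k s ++ nseq (stock k) (base_play 0 1 s)) (plays k s j).
Proof.
move=> Oq kK; elim: j => [|j IH] jm.
  by rewrite /harmonic_sum big_ord0 mulr0.
have -> : plays k s j.+1 = rcons (plays k s j)
    (base_play 1 (j.+1%:R / (8 * (stock k)%:R)) s).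
  have iE : iota 0 j.+1 = rcons (iota 0 j) j by rewrite -addn1 iotaD cats1 add0n.
  by rewrite /plays iE map_rcons.
rewrite -cats1 total_gap_cat/= addr0 /harmonic_sum big_ord_recr/= mulrDr.
by apply: lerD; [apply: IH; exact: ltnW|rewrite -!catA; exact: play_gap].
Qed.

Lemma phases_gap s O k : quiet eta 0 s O -> (k <= K)%N ->
  k%:R * (unit_gap * (p%:R / 2)) <= total_gap eta O (phases k s).
Proof.
move=> Oq; elim: k => [|k IH] kK; first by rewrite mul0r.
rewrite [phases _ _]/= !total_gap_cat -natr1 mulrDl mul1r.
apply: lerD; first by apply: IH; exact: ltnW.
rewrite -[X in X <= _]add0r; apply: lerD.
  apply: total_gap_ge0 => // v; rewrite -catA !mem_cat => /or3P[vO|vP|/nseqP[-> _]].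
  - by case: Oq => h _; exact: h.
  - exact: is_base_play_admissible (phases_is_base_play vP).
  - exact: is_base_play_admissible (stock_play_is_base_play s).
rewrite -catA; apply: le_trans (plays_gap Oq kK (leqnn _)).
have /andP[hh _] := harmonic_sum_pow2 R p.
by rewrite (ler_pM2l unit_gap_gt0).
Qed.

Definition adversary : seq V := counter B Bt (phases K) D xpredT.

Lemma adversary_admissible : {in adversary, forall v, admissible v}.
Proof.
apply: counter_admissible => // s v vs.
exact: is_base_play_admissible (phases_is_base_play vs).
Qed.

Lemma size_adversary : (size adversary <= 256 * E * B ^ 2 * 256 ^ D)%N.
Proof.
have := size_counter eta_gt0 run_bound_gt0 base_weight_gt0 size_base_run D xpredT.
move/leq_trans; apply; rewrite /level /base_weight.
have e : (256 ^ D = 64 ^ D * 4 ^ D)%N by rewrite -expnMn.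
by rewrite e -mulnn; move: (64 ^ D)%N (4 ^ D)%N B => c c' b; lia.
Qed.

Lemma adversary_gap :
  2 ^+ D * (K%:R * (unit_gap * (p%:R / 2))) <= total_gap eta [::] adversary.
Proof.
apply: counter_gap => //.
- exact: run_bound_gt0.
- exact: base_weight_gt0.
- by move=> s v /phases_is_base_play/is_base_play_admissible.
- by move=> s v /phases_is_base_play vs i; exact: is_base_play_tail.
- by move=> s v /phases_is_base_play vs i; exact: is_base_play_le_Bt vs.
- by move=> s v /phases_is_base_play vs i; exact: is_base_play_le vs.
- exact: size_base_run.
- by move=> s O Oq; exact: phases_gap.
(* The empty history exerts no pull, and all bits lie below [D], so only the first branch of
   [budget] occurs. *)
split=> // X _; have g0 i : grad [::] X i = 0 by rewrite /grad big_nil.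
split=> i i2; rewrite g0.
  by rewrite mulr_ge0 ?invr_ge0// exprn_ge0.
move=> h; rewrite /budget.
have iD : (i - 2 < D)%N by have := ltn_ord i; lia.
by rewrite iD divr_ge0// ltW// decay_gt0.
Qed.

End BaseRun.

(** * Regret *)

Section Regret.
Variables (R : realType) (n : nat) (eta : R).
Hypothesis eta_gt0 : 0 < eta.
Notation V := 'rV[R]_n.+1.

Definition normalize (v : V) : V := (\sum_j v 0 j)^-1 *: v.

Lemma admissible_sum_gt0 (v : V) : admissible v -> 0 < \sum_j v 0 j.
Proof.
move=> [v0 [i vi]]; by rewrite (bigD1 i)//= ltr_pwDl// sumr_ge0.
Qed.

Lemma simplex_normalize v : admissible v -> simplex (normalize v).
Proof.
move=> va; have S := admissible_sum_gt0 va; have [v0 _] := va; split=> [i|].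
  by rewrite mxE mulr_ge0// invr_ge0 ltW.
under eq_bigr do rewrite mxE.
by rewrite -mulr_sumr mulVf// gt_eqF.
Qed.

Lemma loss_ge0 (r x : V) : simplex r -> simplex x -> (0 <= loss r x)%E.
Proof.
move=> rS xS; rewrite /loss oppe_ge0 lne_le0 lee_fin.
have [x0 <-] := xS; apply: ler_sum => i _.
by rewrite ler_piMr// simplex_le1.
Qed.

Lemma loss_normalize (v x : V) : admissible v -> (forall i, 0 < x 0 i) ->
  loss (normalize v) x = (ln (\sum_j v 0 j) - ln (dotp x v))%:E.
Proof.
move=> va x0; have S := admissible_sum_gt0 va; have d0 := dotp_gt0 x0 va.
rewrite /loss; have -> : dotp x (normalize v) = (\sum_j v 0 j)^-1 * dotp x v.
  rewrite /dotp [RHS]mulr_sumr; apply: eq_bigr => i _.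
  by rewrite mxE mulrCA.
rewrite lne_EFin ?mulr_gt0 ?invr_gt0// lnM ?posrE ?invr_gt0// lnV ?posrE//.
by rewrite -EFinN opprD opprK.
Qed.

Lemma log_barrier_open (x : V) : (forall i, 0 < x 0 i) ->
  log_barrier x = (- \sum_i ln (x 0 i))%:E.
Proof.
move=> x0; rewrite /log_barrier EFinN -sumEFin; congr (- _)%E.
by apply: eq_bigr => i _; rewrite lne_EFin.
Qed.

Lemma log_barrier_boundary (x : V) : simplex x -> ~ open_simplex x ->
  log_barrier x = +oo%E.
Proof.
move=> xS xN; have [i xi] : exists i, x 0 i <= 0.
  apply: contrapT => /forallNP h; apply: xN; split; last by case: xS.
  by move=> i; have /negP := h i; rewrite -ltNge.
rewrite /log_barrier (_ : (\sum_i lne (x 0 i)%:E)%E = -oo%E)//.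
by apply/esum_eqNyP; exists i; split=> //; rewrite le0_lneNy ?lee_fin.
Qed.

(** * From a sequence of returns to the actual game *)

Section Sequence.
Variable v : nat -> V.
Hypothesis v_adm : forall t, admissible (v t).

(** Rounds are numbered from 1 and [v] from 0, hence [t.-1]. *)
Definition returns_of t : V := normalize (v t.-1).
Definition plays_of t : V := play eta (mkseq v t.-1).

Lemma mkseq_admissible t : {in mkseq v t, forall w, admissible w}.
Proof. by move=> w /mapP[i _ ->]. Qed.

Lemma sum_mkseq t (F : V -> R) : \sum_(w <- mkseq v t) F w = \sum_(i < t) F (v i).
Proof. by rewrite big_map -[X in iota 0 X]subn0 big_mkord. Qed.

Lemma plays_of_open t : open_simplex (plays_of t).
Proof. by have [] := playP eta_gt0 (@mkseq_admissible t.-1). Qed.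

Lemma ftrl_objective_open t (x : V) : open_simplex x ->
  ftrl_objective eta returns_of t.+1 x =
  (obj eta (mkseq v t) x + \sum_(i < t) ln (\sum_j v i 0 j))%:E.
Proof.
move=> [x0 x1]; rewrite /ftrl_objective big_add1 big_mkord.
under eq_bigr do rewrite /returns_of loss_normalize//.
rewrite log_barrier_open// sumEFin -EFinM -EFinD /obj sum_mkseq sumrB mulrN; congr (_%:E).
ring.
Qed.

Lemma lb_ftrl_plays_of T : lb_ftrl eta T returns_of plays_of.
Proof.
move=> [//|t] _; have [xS xmin] := playP eta_gt0 (@mkseq_admissible t).
split; first exact: open_simplexW.
move=> y yS; have [yO|yN] := pselect (open_simplex y).
  by rewrite !ftrl_objective_open// lee_fin lerD2r xmin.
(* On the boundary the barrier is [+oo] and the losses are nonnegative, so the objective is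
   [+oo]. *)
rewrite [X in (_ <= X)%E](_ : _ = +oo%E) ?leey//.
rewrite /ftrl_objective log_barrier_boundary// gt0_muley ?lte_fin ?invr_gt0//.
rewrite addye// -ltNye (@lt_le_trans _ _ 0%E)//.
by apply: sume_ge0 => i _; apply: loss_ge0 => //; exact: simplex_normalize.
Qed.

(** The minimal objective values telescope; each step leaves over the loss of the current play on
    the return just revealed. *)
Lemma total_gapE (H P : seq V) : total_gap eta H P = obj eta H (play eta H)
  - obj eta (H ++ P) (play eta (H ++ P))
  - \sum_(i < size P) ln (dotp (play eta (H ++ take i P)) (nth 0 P i)).
Proof.
elim: P H => [|w P IH] H /=; first by rewrite big_ord0 cats0 subrr subr0.
rewrite IH big_ord_recl/= cats0 cat_rcons /gap.
under eq_bigr do rewrite cat_rcons.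
rewrite /obj -[in X in X - _]cats1 !big_cat/= big_seq1; ring.
Qed.

(** The regret against the final minimizer [u] exceeds the total gap by the barrier term of [u]
    minus its minimal value, which is nonnegative. *)
Lemma regret_ge T :
  ((total_gap eta [::] (mkseq v T))%:E <= regret T returns_of plays_of)%E.
Proof.
set u := play eta (mkseq v T).
have [uS _] := playP eta_gt0 (@mkseq_admissible T).
apply: (@le_trans _ _ (\sum_(1 <= t < T.+1)
    (loss (returns_of t) (plays_of t) - loss (returns_of t) u))%E); last first.
  by apply: ereal_sup_ubound; exists u => //; exact: open_simplexW.
rewrite big_add1 big_mkord.
have termE (i : 'I_T) : (loss (returns_of i.+1) (plays_of i.+1)
    - loss (returns_of i.+1) u)%E
    = (ln (dotp u (v i)) - ln (dotp (play eta (mkseq v i)) (v i)))%:E.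
  have [u0 _] := uS; have [x0 _] := plays_of_open i.+1.
  rewrite /returns_of !loss_normalize// -EFinB; congr (_%:E).
  by rewrite /plays_of/=; ring.
under eq_bigr do rewrite termE.
rewrite sumEFin lee_fin total_gapE cat0s sumrB size_mkseq.
have -> : \sum_(i < T)
      ln (dotp (play eta ([::] ++ take i (mkseq v T))) (nth 0 (mkseq v T) i))
    = \sum_(i < T) ln (dotp (play eta (mkseq v i)) (v i)).
  apply: eq_bigr => i _; rewrite cat0s nth_mkseq//.
  by rewrite /mkseq -map_take take_iota (minn_idPl (ltnW (ltn_ord i))).
rewrite lerD2r.
have [_ /(_ _ uS) h] := playP eta_gt0 (@mkseq_admissible 0).
rewrite -[X in _ <= X](_ : obj eta [::] u - obj eta (mkseq v T) u = _).
  by rewrite lerB.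
by rewrite /obj big_nil sum_mkseq; ring.
Qed.

End Sequence.
End Regret.

Lemma worst_case_regret_ge (R : realType) (eta : R) (D T E p K : nat) :
  0 < eta -> (0 < E)%N -> (0 < K)%N -> eta <= E%:R -> eta^-1 <= E%:R ->
  (256 * E * run_bound E p K ^ 2 * 256 ^ D <= T)%N ->
  ((2 ^+ D * (K%:R * (unit_gap R E * (p%:R / 2))))%:E
    <= worst_case_regret D.+2 eta T)%E.
Proof.
move=> eta0 E0 K0 etaE etaVE NT.
pose A := adversary R D E p K.
have one_adm : admissible (const_mx 1 : 'rV[R]_D.+2).
  by split=> [i|]; [rewrite mxE|exists ord0; rewrite mxE].
(* The default of [nth] pads the adversary with all-ones returns up to round [T]; their gaps are
   nonnegative. *)
pose v := nth (const_mx 1 : 'rV[R]_D.+2) A.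
have v_adm t : admissible (v t).
  have [tA|At] := ltnP t (size A); last by rewrite /v nth_default.
  by apply: (adversary_admissible E0 K0); exact: mem_nth.
have AT : (size A <= T)%N by apply: leq_trans NT; exact: (size_adversary _ eta0).
apply: (@le_trans _ _ (regret T (returns_of v) (plays_of eta v))); last first.
  apply: ereal_sup_ubound; exists (returns_of v), (plays_of eta v); split=> //.
  - by move=> t _; exact: simplex_normalize.
  - exact: lb_ftrl_plays_of.
apply: le_trans (regret_ge eta0 v_adm T); rewrite lee_fin.
have -> : mkseq v T = A ++ [seq v i | i <- iota (size A) (T - size A)].
  rewrite -[in RHS](mkseq_nth (const_mx 1) A) /mkseq -map_cat size_map size_iota.
  by rewrite -iotaD subnKC.
rewrite total_gap_cat.
apply: le_trans (@adversary_gap R D eta eta0 E p K E0 K0 etaE etaVE) _.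
rewrite lerDl total_gap_ge0// => w; rewrite mem_cat => /orP[|/mapP[i _ ->]//].
exact: (adversary_admissible E0 K0).
Qed.

(** * Choice of the parameters in terms of the horizon *)

Lemma mul_add8_le k : ((k + 8) * k <= 8 * 2 ^ k)%N.
Proof.
elim: k => [|[|k] IH] //; rewrite expnS.
have := ltn_expl k.+1 (isT : (1 < 2)%N); lia.
Qed.

(** With [K = log2 p] one has [128 * p.+1 <= 2 ^ (K + 8)], so by [mul_add8_le] its [K]-th power is
    only exponential in [p]. *)
Lemma run_bound_le E p : (1 < p)%N ->
  (run_bound E p (trunc_log 2 p) <= 160 * E ^ 2 * 2 ^ (10 * p))%N.
Proof.
move=> p1; set k := trunc_log 2 p.
have /andP[kp pk] := trunc_log_bounds (isT : (1 < 2)%N) (ltnW p1 : (0 < p)%N).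
have k0 : (0 < k)%N by rewrite trunc_log_gt0.
rewrite -/k in kp pk.
have h1 : ((128 * p.+1) ^ k <= 2 ^ (8 * p))%N.
  apply: (@leq_trans ((2 ^ (k + 8)) ^ k)).
    by rewrite leq_exp2r// addnS -addSn addnC expnD leq_mul2l pk orbT.
  rewrite -expnM leq_exp2l//; apply: leq_trans (mul_add8_le k) _.
  by rewrite leq_mul2l kp orbT.
have h2 : (k <= 2 ^ p)%N.
  apply: leq_trans (ltnW (ltn_expl k (isT : (1 < 2)%N))) _.
  by apply: leq_trans kp (ltnW (ltn_expl p _)).
have e : (2 ^ (10 * p) = 2 ^ p * 2 ^ p * 2 ^ (8 * p))%N.
  by rewrite -!expnD; congr (_ ^ _)%N; lia.
rewrite /run_bound /stock e.
have := leq_mul (leq_mul h2 (leqnn (2 ^ p)%N)) h1.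
move: (2 ^ p)%N ((128 * p.+1) ^ k)%N (2 ^ (8 * p))%N (E ^ 2)%N => a b c e2 h.
have := leq_mul (leqnn (160 * e2)%N) h; lia.
Qed.

(** After squaring, one factor [T] absorbs [2 ^ (40 * p)] and the other the constants and the
    dimension. *)
Lemma rounds_le E D p T : (1 < p)%N -> (p <= trunc_log 2 T %/ 40)%N -> (0 < T)%N ->
  ((256 * E * (160 * E ^ 2) ^ 2) ^ 2 * 2 ^ (16 * D) <= T)%N ->
  (256 * E * run_bound E p (trunc_log 2 p) ^ 2 * 256 ^ D <= T)%N.
Proof.
move=> p1 pT T0 hT; rewrite -leq_sqr.
have h1 : (2 ^ (40 * p) <= T)%N.
  apply: leq_trans (trunc_logP (isT : (1 < 2)%N) T0).
  by rewrite leq_exp2l// mulnC -leq_divRL.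
apply: (@leq_trans ((256 * E * (160 * E ^ 2 * 2 ^ (10 * p)) ^ 2 * 256 ^ D) ^ 2)).
  rewrite leq_sqr leq_mul2r leq_mul2l leq_sqr run_bound_le// !orbT//.
have e : ((256 * E * (160 * E ^ 2 * 2 ^ (10 * p)) ^ 2 * 256 ^ D) ^ 2 =
  (256 * E * (160 * E ^ 2) ^ 2) ^ 2 * 2 ^ (16 * D) * 2 ^ (40 * p))%N.
  have -> : (40 * p = 10 * p * 2 * 2)%N by lia.
  have -> : (16 * D = 8 * D * 2)%N by lia.
  have -> : (256 ^ D = 2 ^ (8 * D))%N by rewrite expnM.
  rewrite !(expnM 2 _ 2); move: (256 * E)%N (160 * E ^ 2)%N => f g.
  by move: (2 ^ (10 * p))%N (2 ^ (8 * D))%N => a b; rewrite -!mulnn; lia.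
by rewrite e -mulnn leq_mul.
Qed.

Lemma ln2_le1 (R : realType) : ln 2 <= 1 :> R.
Proof. by have -> : 2 = 1 + 1 :> R by []; apply: le_ln1Dx; lra. Qed.

Lemma lnX2_le (R : realType) (x : R) k : 0 < x -> x <= 2 ^+ k -> ln x <= k%:R.
Proof.
move=> x0 xk; apply: (@le_trans _ _ (ln (2 ^+ k))).
  by rewrite ler_ln ?posrE// exprn_gt0.
by rewrite lnXn// -[ln 2 *+ k]mulr_natl ler_piMr// ln2_le1.
Qed.

(** First [ln T <= 40 * (p + 1) <= 60 * p] since [p >= 2]; then [60 * p <= 2 ^ (k + 7)] and
    [k + 7 <= 8 * k]. *)
Lemma ln_lnln_le (R : realType) T : let p := (trunc_log 2 T %/ 40)%N in
  (1 < p)%N ->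
  ln T%:R * ln (ln T%:R) <= 60 * p%:R * (8 * (trunc_log 2 p)%:R) :> R.
Proof.
move=> p p1; set k := trunc_log 2 p.
have T1 : (1 < T)%N.
  rewrite ltnNge; apply/negP => T1; move: p1; rewrite /p.
  by move: T T1 {p k} => [|[]]// _; rewrite ?trunc_log0 ?trunc_log1 div0n.
have k0 : (0 < k)%N by rewrite trunc_log_gt0.
have /andP[_ Tlt] := trunc_log_bounds (isT : (1 < 2)%N) (ltnW T1).
have /andP[_ pk] := trunc_log_bounds (isT : (1 < 2)%N) (ltnW p1).
rewrite -/k in pk.
have hl : (trunc_log 2 T < p.+1 * 40)%N by rewrite ltn_ceil.
have lnT0 : 0 < ln T%:R :> R by rewrite ln_gt0// ltr1n.
have lnT : ln T%:R <= 60 * p%:R :> R.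
  apply: (@le_trans _ _ (p.+1 * 40)%:R).
    apply: lnX2_le; first by rewrite ltr0n ltnW.
    by rewrite -natrX ler_nat; apply: leq_trans (ltnW Tlt) _; rewrite leq_exp2l.
  by rewrite -natrM ler_nat; lia.
have lnlnT : ln (ln T%:R) <= 8 * k%:R :> R.
  apply: (@le_trans _ _ (k + 7)%:R); last by rewrite -natrM ler_nat; lia.
  apply: lnX2_le => //; apply: le_trans lnT _.
  rewrite -natrX -natrM ler_nat (_ : (k + 7 = k.+1 + 6)%N) ?expnD; last by lia.
  move: pk; move: (2 ^ k.+1)%N => c; rewrite (_ : (2 ^ 6 = 64)%N)//; lia.
apply: le_trans (ler_wpM2l (ltW lnT0) lnlnT) _.
by apply: ler_wpM2r => //; rewrite -natrM.
Qed.

Theorem corollary11 (R : realType) (eta : R) (eta_gt0 : 0 < eta) :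
  exists b K kappa : R,
    [/\ 0 < b, 0 < K, 0 < kappa &
      forall d T : nat, (2 <= d)%N -> K * 2 `^ (b * d%:R) < T%:R ->
        ((kappa * 2 ^+ d * ln T%:R * ln (ln T%:R))%:E
           <= worst_case_regret d eta T)%E].
Proof.
pose E := (Num.trunc (eta + eta^-1)).+1.
have etaV_gt0 : 0 < eta^-1 by rewrite invr_gt0.
have hE : eta + eta^-1 < E%:R by exact: truncnS_gt.
have etaE : eta <= E%:R by lra.
have etaVE : eta^-1 <= E%:R by lra.
(* Introducing [C] through an existential keeps this large constant opaque. *)
have [C CE] : exists C, C = ((256 * E * (160 * E ^ 2) ^ 2) ^ 2)%N.
  by exists ((256 * E * (160 * E ^ 2) ^ 2) ^ 2)%N.
have C0 : (0 < C)%N.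
  by rewrite CE expn_gt0 muln_gt0 muln_gt0 expn_gt0 muln_gt0 expn_gt0.
have g0 : 0 < unit_gap R E by exact: unit_gap_gt0.
(* With [b = 40] and [d >= 2], [T] is at least [2 ^ 80], hence [p >= 2]; 40 also covers the exponent
   [16 * D] of [rounds_le]. In the third witness, 60 comes from [ln_lnln_le], and [64 = 8 * 4 * 2]
   from the 8 there, from the two assets that carry no bit, and from [p / 2]. *)
exists 40, C%:R, (unit_gap R E / 64 / 60).
split; [by rewrite ltr0n|by rewrite ltr0n|by rewrite !divr_gt0|].
move=> [|[|D]]// T _ hT.
have {}hT : (C * 2 ^ (40 * D.+2) < T)%N.
  move: hT; rewrite -natrM powR_mulrn// -natrX -natrM ltr_nat.
  exact.
have h80 : (2 ^ 80 <= T)%N.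
  apply: leq_trans (ltnW hT); apply: (@leq_trans (1 * 2 ^ (40 * D.+2))).
    by rewrite mul1n leq_exp2l//; lia.
  by rewrite leq_mul2r C0 orbT.
have T0 : (0 < T)%N by apply: leq_ltn_trans hT.
set p := (trunc_log 2 T %/ 40)%N.
have p1 : (1 < p)%N.
  rewrite /p leq_divRL//; exact: trunc_log_max.
have k0 : (0 < trunc_log 2 p)%N by rewrite trunc_log_gt0.
have NT : (256 * E * run_bound E p (trunc_log 2 p) ^ 2 * 256 ^ D <= T)%N.
  apply: rounds_le => //; apply: leq_trans (ltnW hT).
  by rewrite -CE leq_mul2l leq_exp2l//; apply/orP; right; lia.
apply: le_trans (worst_case_regret_ge eta_gt0 (ltn0Sn _) k0 etaE etaVE NT).
rewrite lee_fin -mulrA.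
have c0 : 0 <= unit_gap R E / 64 / 60 * 2 ^+ D.+2.
  by rewrite mulr_ge0// ltW// !divr_gt0.
apply: le_trans (ler_wpM2l c0 (ln_lnln_le R p1)) _.
rewrite -/p !exprS.
rewrite le_eqVlt; apply/orP; left; apply/eqP.
by field.
Qed.
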